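(* Let $p$ be a prime. For every countable product $U$ of finite groups (endowed with the product topology), there exists a second countable totally disconnected locally compact group $G$ whose underlying group is a subgroup of $\mathrm{PL}(\mathbb{Q}_p)$, such that $G$ is locally isomorphic to $U$ and: (i) the only IRS's of $G$ are the convex combinations of $\delta_{\{1\}}$ and $\delta_G$; (ii) $G$ has no URS other than $\{\{1\}\}$ and $\{G\}$.
   Context: $\mathrm{PL}(\mathbb{Q}_p)$ is the group of piecewise affine homeomorphisms of $\mathbb{Q}_p$: homeomorphisms $g$ of $\mathbb{Q}_p$ for which there is a (possibly infinite) partition of $\mathbb{Q}_p$ into compact open subsets $(\mathcal{U}_i)_{i\ge 0}$ such that for every $i$ the restriction of $g$ to $\mathcal{U}_i$ coincides with the restriction of a map $x\mapsto ax+b$ with $a\in\mathbb{Q}_p^*$, $b\in\mathbb{Q}_p$ (the $\mathcal{U}_i$ need not be $g$-invariant). No topology on $\mathrm{PL}(\mathbb{Q}_p)$ is used: $G$ is a subgroup of the abstract group $\mathrm{PL}(\mathbb{Q}_p)$, endowed with its own group topology. Two locally compact groups are locally isomorphic if they have isomorphic (as topological groups) open subgroups. All locally compact groups are Hausdorff and second countable. For such a group $G$, $\mathrm{Sub}(G)$ is the set of closed subgroups of $G$ with the Chabauty topology, which has as sub-basis the sets $\{H: H\cap V\neq\varnothing\}$ ($V\subset G$ relatively compact open) and $\{H: H\cap C=\varnothing\}$ ($C\subset G$ compact). It is compact and metrisable, and $G$ acts on it continuously by conjugation. An IRS (invariant random subgroup) of $G$ is a Borel probability measure on $\mathrm{Sub}(G)$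 invariant under the conjugation action; $\delta_H$ denotes the Dirac mass at $H$. A URS (uniformly recurrent subgroup) of $G$ is a minimal (non-empty) closed conjugation-invariant subset of $\mathrm{Sub}(G)$. *)

(* Defs.v *)
From HB Require Import structures.
From mathcomp Require Import all_boot all_order all_algebra all_fingroup.
From mathcomp Require Import all_classical all_reals all_analysis.

Set Implicit Arguments.
Unset Strict Implicit.
Unset Printing Implicit Defensive.

Import Order.TTheory GRing.Theory Num.Theory.

Local Open Scope classical_set_scope.

(* p-adic integers, as the inverse limit of the rings Z/p^n: x n is the
   representative of x mod p^n, and padic_coherent forces 0 <= x n < p^n. *)
Definition padic_coherent (p : nat) (x : nat -> nat) : Prop :=
  forall n, x n = x n.+1 %% p ^ n.

Record padic_int (p : nat) (p_prime : prime p) : Type := PadicInt {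
  residue :> nat -> nat;
  residue_coherent : padic_coherent p residue }.

Section PadicInt.
Variables (p : nat) (p_prime : prime p).
Local Notation padic_int := (padic_int p_prime).
Local Notation padic_coherent := (padic_coherent p).
Local Notation PadicInt := (@PadicInt p p_prime).

HB.instance Definition _ := gen_eqMixin padic_int.
HB.instance Definition _ := gen_choiceMixin padic_int.

Lemma padic_intP (x y : padic_int) : (forall n, x n = y n) -> x = y.
Proof.
case: x y => [x cx] [y cy] /= /funext xy; subst y.
by rewrite (Prop_irrelevance cx cy).
Qed.

Lemma residue_mod (x : padic_int) n : x n %% p ^ n = x n.
Proof. by rewrite [in RHS](residue_coherent x) [x n]residue_coherent modn_mod. Qed.

Lemma residue_le (x : padic_int) m n : m <= n -> x m = x n %% p ^ m.
Proof.
move=> /subnK <-; elim: (n - m) => [|k IH]; first by rewrite add0n residue_mod.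
rewrite IH (residue_coherent x (k + m)) addSn modn_dvdm //.
by rewrite dvdn_exp2l // leq_addl.
Qed.

Lemma coherent_mod (f : nat -> nat) :
  (forall n, f n.+1 = f n %[mod p ^ n]) ->
  padic_coherent (fun n => f n %% p ^ n).
Proof.
move=> fE n /=; rewrite -(fE n) modn_dvdm //.
by rewrite dvdn_exp2l.
Qed.

Definition padic_zero : padic_int.
Proof. by exists (fun=> 0) => n; rewrite mod0n. Defined.

Definition padic_one : padic_int.
Proof. by exists (fun n => 1 %% p ^ n); apply: coherent_mod. Defined.

Lemma padic_addP (x y : padic_int) :
  padic_coherent (fun n => (x n + y n) %% p ^ n).
Proof.
by apply: coherent_mod => n; rewrite -modnDm -!residue_coherent.
Qed.

Definition padic_add x y := PadicInt (padic_addP x y).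

Lemma padic_mulP (x y : padic_int) :
  padic_coherent (fun n => (x n * y n) %% p ^ n).
Proof.
by apply: coherent_mod => n; rewrite -modnMm -!residue_coherent.
Qed.

Definition padic_mul x y := PadicInt (padic_mulP x y).

Lemma residue_lt (x : padic_int) n : x n < p ^ n.
Proof. by rewrite -residue_mod ltn_mod expn_gt0 prime_gt0. Qed.

Lemma padic_oppP (x : padic_int) :
  padic_coherent (fun n => (p ^ n - x n) %% p ^ n).
Proof.
apply: coherent_mod => n; apply/eqP.
rewrite -(eqn_modDr (x n.+1)) subnK ?(ltnW (residue_lt _ _))//.
rewrite -[in X in _ == X]modnDmr -residue_coherent.
by rewrite subnK ?(ltnW (residue_lt _ _))// modnn expnS modnMl.
Qed.

Definition padic_opp x := PadicInt (padic_oppP x).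

Lemma padic_addA : associative padic_add.
Proof.
by move=> x y z; apply: padic_intP => n /=; rewrite modnDml modnDmr addnA.
Qed.

Lemma padic_addC : commutative padic_add.
Proof. by move=> x y; apply: padic_intP => n /=; rewrite addnC. Qed.

Lemma padic_add0 : left_id padic_zero padic_add.
Proof. by move=> x; apply: padic_intP => n /=; rewrite add0n residue_mod. Qed.

Lemma padic_addN : left_inverse padic_zero padic_opp padic_add.
Proof.
move=> x; apply: padic_intP => n /=.
by rewrite modnDml subnK ?modnn // ltnW // residue_lt.
Qed.

HB.instance Definition _ := GRing.isZmodule.Build padic_int
  padic_addA padic_addC padic_add0 padic_addN.

Lemma padic_mulA : associative padic_mul.
Proof.
by move=> x y z; apply: padic_intP => n /=; rewrite modnMml modnMmr mulnA.
Qed.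

Lemma padic_mulC : commutative padic_mul.
Proof. by move=> x y; apply: padic_intP => n /=; rewrite mulnC. Qed.

Lemma padic_mul1 : left_id padic_one padic_mul.
Proof.
by move=> x; apply: padic_intP => n /=; rewrite modnMml mul1n residue_mod.
Qed.

Lemma padic_mulD : left_distributive padic_mul padic_add.
Proof.
move=> x y z; apply: padic_intP => n /=.
by rewrite modnMml modnDm mulnDl.
Qed.

Lemma padic_oner_neq0 : padic_one != padic_zero.
Proof.
apply/eqP => /(congr1 (fun x : padic_int => x 1%N)) /=.
by rewrite expn1 modn_small // prime_gt1.
Qed.

HB.instance Definition _ := GRing.Zmodule_isComNzRing.Build padic_int
  padic_mulA padic_mulC padic_mul1 padic_mulD padic_oner_neq0.

Definition padic_unit : {pred padic_int} :=
  fun x => `[< exists y : padic_int, (y * x = 1)%R >].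

Definition padic_inv (x : padic_int) : padic_int :=
  if pselect (exists y : padic_int, (y * x = 1)%R) is left ex
  then projT1 (cid ex) else x.

Lemma padic_mulV : {in padic_unit, left_inverse 1%R padic_inv *%R}.
Proof.
move=> x /asboolP ux; rewrite /padic_inv; case: pselect => // ex.
exact: projT2 (cid ex).
Qed.

Lemma padic_unitPl (x y : padic_int) : (y * x = 1)%R -> padic_unit x.
Proof. by move=> yx; apply/asboolP; exists y. Qed.

Lemma padic_inv_out : {in [predC padic_unit], padic_inv =1 id}.
Proof.
move=> x; rewrite inE /= => /asboolPn nx.
by rewrite /padic_inv; case: pselect.
Qed.

HB.instance Definition _ := GRing.ComNzRing_hasMulInverse.Build padic_int
  padic_mulV padic_unitPl padic_inv_out.

Lemma padic_neq0 (x : padic_int) : x != 0%R -> exists n, x n != 0%N.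
Proof.
move=> x0; apply: contrapT => /forallNP H; move/eqP: x0; apply.
by apply: padic_intP => n; apply/eqP; move/negP: (H n); rewrite negbK.
Qed.

Lemma padic_integral (x y : padic_int) :
  (x * y = 0 -> (x == 0) || (y == 0))%R.
Proof.
move=> xy0; apply: contraT; rewrite negb_or => /andP[/padic_neq0[m xm]].
move=> /padic_neq0[k yk].
have bound (z : padic_int) i j : i <= j -> z i != 0%N ->
    (0 < z j) && (logn p (z j) < i).
  move=> ij; rewrite (residue_le z ij) => zi.
  have z0 : 0 < z j by rewrite lt0n; apply: contraNneq zi => ->; rewrite mod0n.
  by rewrite z0 ltnNge -pfactor_dvdn.
have /andP[x0 xl] := bound x m (m + k) (leq_addr _ _) xm.
have /andP[y0 yl] := bound y k (m + k) (leq_addl _ _) yk.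
have /(congr1 (fun z : padic_int => z (m + k))) /= /eqP := xy0.
rewrite -/(dvdn _ _) pfactor_dvdn ?muln_gt0 ?x0 // lognM // leqNgt.
by rewrite -addnS leq_add // ltnW.
Qed.

HB.instance Definition _ :=
  GRing.ComUnitRing_isIntegral.Build padic_int padic_integral.

End PadicInt.

(* The field Q_p = Frac(Z_p). *)
Definition padic (p : nat) (p_prime : prime p) : Type :=
  {fraction (padic_int p_prime)}.

HB.instance Definition _ p (p_prime : prime p) :=
  GRing.Field.on (padic p_prime).

Section PadicTopology.
Variables (p : nat) (p_prime : prime p).
Local Notation Qp := (padic p_prime).
Local Notation "z %:F" := (@FracField.tofrac (padic_int p_prime) z).

(* The ball x + p^n Z_p. *)
Definition padic_ball (x : Qp) (n : nat) : set Qp :=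
  [set y | exists z : padic_int p_prime, (y = x + p%:R ^+ n * z%:F)%R].

Definition padic_open : set_system Qp :=
  [set U | forall x, U x -> exists n, padic_ball x n `<=` U].

Lemma padic_ball_le (x : Qp) m n :
  m <= n -> padic_ball x n `<=` padic_ball x m.
Proof.
move=> /subnK <- y [z ->]; exists (p%:R ^+ (n - m) * z)%R.
by rewrite rmorphM rmorphXn rmorph_nat mulrA exprD [(_ ^+ m * _)%R]mulrC.
Qed.

Lemma padic_openT : padic_open setT.
Proof. by move=> x _; exists 0%N. Qed.

Lemma padic_openI : setI_closed padic_open.
Proof.
move=> A B oA oB x [/oA[m Am] /oB[n Bn]]; exists (maxn m n) => y xy.
by split; [apply: Am|apply: Bn]; apply: padic_ball_le xy;
  rewrite ?leq_maxl ?leq_maxr.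
Qed.

Lemma padic_open_bigU (I : Type) (f : I -> set Qp) :
  (forall i, padic_open (f i)) -> padic_open (\bigcup_i f i).
Proof.
move=> of_ x [i _ /of_[n fin]]; exists n => y /fin fiy.
by exists i.
Qed.

HB.instance Definition _ := isOpenTopological.Build Qp
  padic_openT padic_openI padic_open_bigU.

End PadicTopology.

Section Homeomorphisms.
Variable T : topologicalType.

Definition is_homeo (f : T -> T) : Prop :=
  continuous f /\
  exists g : T -> T, [/\ cancel f g, cancel g f & continuous g].

Record homeo : Type := Homeo {
  homeo_fun :> T -> T;
  homeoP : is_homeo homeo_fun }.

HB.instance Definition _ := gen_eqMixin homeo.
HB.instance Definition _ := gen_choiceMixin homeo.

Lemma homeo_inj (f g : homeo) : f =1 g -> f = g.
Proof.
case: f g => [f hf] [g hg] /= /funext fg; subst g.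
by rewrite (Prop_irrelevance hf hg).
Qed.

Lemma homeo_idP : is_homeo (@idfun T).
Proof. by split; [|exists idfun; split=> //]; move=> x; exact: cvg_id. Qed.

Definition homeo_id := Homeo homeo_idP.

Lemma homeo_compP (f g : homeo) : is_homeo (f \o g).
Proof.
have [cf [f' [fK f'K cf']]] := homeoP f.
have [cg [g' [gK g'K cg']]] := homeoP g.
split; first by move=> x; apply: continuous_comp; [exact: cg|exact: cf].
exists (g' \o f'); split; [exact: can_comp|exact: can_comp|].
by move=> x; apply: continuous_comp; [exact: cf'|exact: cg'].
Qed.

Definition homeo_comp f g := Homeo (homeo_compP f g).

Definition homeo_inv_fun (f : homeo) : T -> T := projT1 (cid (homeoP f).2).

Lemma homeo_inv_funP (f : homeo) :
  [/\ cancel f (homeo_inv_fun f), cancel (homeo_inv_fun f) f &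
      continuous (homeo_inv_fun f)].
Proof. exact: projT2 (cid (homeoP f).2). Qed.

Lemma homeo_invP (f : homeo) : is_homeo (homeo_inv_fun f).
Proof.
have [fK f'K cf'] := homeo_inv_funP f.
by split=> //; exists f; split=> //; case: (homeoP f).
Qed.

Definition homeo_inv f := Homeo (homeo_invP f).

Lemma homeo_compA : associative homeo_comp.
Proof. by move=> f g h; exact: homeo_inj. Qed.

Lemma homeo_comp1f : left_id homeo_id homeo_comp.
Proof. by move=> f; exact: homeo_inj. Qed.

Lemma homeo_compf1 : right_id homeo_id homeo_comp.
Proof. by move=> f; exact: homeo_inj. Qed.

Lemma homeo_compVf : left_inverse homeo_id homeo_inv homeo_comp.
Proof.
by move=> f; apply: homeo_inj => x /=; have [fK _ _] := homeo_inv_funP f; exact: fK.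
Qed.

Lemma homeo_compfV : right_inverse homeo_id homeo_inv homeo_comp.
Proof.
by move=> f; apply: homeo_inj => x /=; have [_ fK _] := homeo_inv_funP f; exact: fK.
Qed.

HB.instance Definition _ := isGroup.Build homeo homeo_compA
  homeo_comp1f homeo_compf1 homeo_compVf homeo_compfV.

End Homeomorphisms.

(* D is the index set of the partition, so that its pieces are nonempty and
   countably many; it is necessarily infinite, since Q_p is not compact. *)
Definition PL (p : nat) (p_prime : prime p) : set (homeo (padic p_prime)) :=
  [set g | exists (D : set nat) (U : nat -> set (padic p_prime)),
    partition D U setT /\
    forall i, D i ->
      [/\ compact (U i), open (U i) &
          exists a b : padic p_prime,
            (a != 0)%R /\ forall x, U i x -> (g x = a * x + b)%R]].

HB.mixin Record isTopologicalGroup G & Topological G & monoid.Group G := {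
  mulg_continuous : continuous (fun x : G * G => (x.1 * x.2)%g);
  invg_continuous : continuous (fun x : G => (x^-1)%g) }.

#[short(type="topGroupType")]
HB.structure Definition TopologicalGroup :=
  {G of Topological G & monoid.Group G & isTopologicalGroup G}.

HB.mixin Record isLCSCGroup G & Topological G := {
  lcsc_hausdorff : hausdorff_space G;
  lcsc_locally_compact : locally_compact [set: G];
  lcsc_second_countable : @second_countable G }.

#[short(type="lcscGroupType")]
HB.structure Definition LCSCGroup :=
  {G of TopologicalGroup G & isLCSCGroup G}.

Lemma group_closed_setP (G : topGroupType) (H : set G) :
  group_closed [in H] <->
  H 1%g /\ (forall x y, H x -> H y -> H (x * y^-1)%g).
Proof.
split=> -[H1 HB]; split; first by move: H1; rewrite unfold_in => /set_mem.
- move=> x y Hx Hy; have := HB x y; rewrite !unfold_in.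
  by move=> /(_ (mem_set Hx) (mem_set Hy)) /set_mem.
- by rewrite unfold_in; exact/mem_set.
- move=> x y; rewrite !unfold_in => /set_mem Hx /set_mem Hy.
  by apply/mem_set; exact: HB.
Qed.

(* Continuity on A and B is for the subspace topologies. *)
Definition locally_isomorphic (G H : topGroupType) : Prop :=
  exists (A : set G) (B : set H),
    [/\ open A, group_closed [in A], open B, group_closed [in B] &
    exists (f : G -> H) (f' : H -> G),
      [/\ set_fun A B f /\ set_fun B A f',
          {in A, cancel f f'} /\ {in B, cancel f' f},
          {in A &, {morph f : x y / (x * y)%g}},
          {within A, continuous f} &
          {within B, continuous f'}]].

Section ProductGroup.
Variables (I : countType) (K : I -> finGroupType).

Definition prod_group : Type :=
  prod_topology (fun i => discrete_topology (K i)).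

HB.instance Definition _ := Topological.on prod_group.

Definition prod_one : prod_group := fun i => (1%g : K i).
Definition prod_inv (x : prod_group) : prod_group :=
  fun i => ((x i : K i)^-1)%g.
Definition prod_mul (x y : prod_group) : prod_group :=
  fun i => ((x i : K i) * (y i : K i))%g.

Lemma prod_mulA : associative prod_mul.
Proof. by move=> x y z; apply: functional_extensionality_dep => i; exact: mulgA. Qed.

Lemma prod_mul1g : left_id prod_one prod_mul.
Proof. by move=> x; apply: functional_extensionality_dep => i; exact: mul1g. Qed.

Lemma prod_mulg1 : right_id prod_one prod_mul.
Proof. by move=> x; apply: functional_extensionality_dep => i; exact: mulg1. Qed.

Lemma prod_mulVg : left_inverse prod_one prod_inv prod_mul.
Proof. by move=> x; apply: functional_extensionality_dep => i; exact: mulVg. Qed.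

Lemma prod_mulgV : right_inverse prod_one prod_inv prod_mul.
Proof. by move=> x; apply: functional_extensionality_dep => i; exact: mulgV. Qed.

HB.instance Definition _ := isGroup.Build prod_group
  prod_mulA prod_mul1g prod_mulg1 prod_mulVg prod_mulgV.

Lemma prod_coord_near (x : prod_group) i : \forall y \near x, y i = x i.
Proof.
exact: (@proj_continuous I (fun i => discrete_topology (K i)) i x)
  [set x i] (@discrete_set1 (discrete_topology (K i)) (x i)).
Qed.

Lemma continuous_prod_group (T : topologicalType) (f : T -> prod_group) :
  (forall x i, \forall y \near x, f y i = f x i) -> continuous f.
Proof.
move=> fP x; apply/cvg_sup.
move=> i; apply/cvg_image.
  rewrite eqEsubset; split=> // k _.
  by exists (dfwith (prod_one : forall i, K i) i k) => //; exact: dfwithin.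
move=> A /= A1; exists (@proj _ (fun i => discrete_topology (K i)) i @^-1` A).
  apply: filterS (fP x i) => y /= fy; rewrite /proj fy.
  exact: (nbhs_singleton A1).
rewrite eqEsubset; split=> [k [g Ag <-]//|k Ak].
by exists (dfwith (prod_one : forall i, K i) i k); rewrite /= ?/proj ?dfwithin.
Qed.

Lemma prod_mulg_continuous :
  continuous (fun x : prod_group * prod_group => (x.1 * x.2)%g).
Proof.
apply: continuous_prod_group => -[x y] i.
exists ([set z : prod_group | z i = x i], [set z : prod_group | z i = y i]).
  by split; exact: prod_coord_near.
by move=> [z t] /= [zx ty]; congr (_ * _)%g.
Qed.

Lemma prod_invg_continuous : continuous (fun x : prod_group => (x^-1)%g).
Proof.
apply: continuous_prod_group => x i.
apply: filterS (prod_coord_near x i) => y yx.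
by congr (_^-1)%g.
Qed.

HB.instance Definition _ := isTopologicalGroup.Build prod_group
  prod_mulg_continuous prod_invg_continuous.

End ProductGroup.

Record closed_subgroup (G : topGroupType) : Type := ClosedSubgroup {
  subgroup_set :> set G;
  closed_subgroup_closed : closed subgroup_set;
  closed_subgroup_group : group_closed [in subgroup_set] }.

Section Chabauty.
Variable G : topGroupType.
Local Notation Sub := (closed_subgroup G).

Lemma closed_subgroup_inj (H K : Sub) : (H : set G) = K -> H = K.
Proof.
case: H K => [H cH gH] [K cK gK] /= HK; subst K.
by rewrite (Prop_irrelevance cH cK) (Prop_irrelevance gH gK).
Qed.

Lemma whole_subgroup_group : group_closed [in [set: G]].
Proof. exact/group_closed_setP. Qed.

Definition whole_subgroup : Sub :=
  ClosedSubgroup closedT whole_subgroup_group.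

HB.instance Definition _ := gen_eqMixin Sub.
HB.instance Definition _ := gen_choiceMixin Sub.
HB.instance Definition _ := isPointed.Build Sub whole_subgroup.

Definition chabauty_subbase : set (set Sub) :=
  [set W | (exists V : set G, [/\ open V, compact (closure V) &
              W = [set H : Sub | H `&` V !=set0]]) \/
           (exists C : set G, compact C /\
              W = [set H : Sub | H `&` C = set0])].

HB.instance Definition _ :=
  isSubBaseTopological.Build Sub chabauty_subbase idfun.

Definition conj_set (g : G) (H : set G) : set G :=
  [set (g * h * g^-1)%g | h in H].

Lemma conj_setE (g : G) (H : set G) :
  conj_set g H = (fun x => (g^-1 * x * g)%g) @^-1` H.
Proof.
rewrite eqEsubset; split=> [_ [h Hh <-] /=|x /= Hx].
  by rewrite !mulgA mulVg mul1g -mulgA mulVg mulg1.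
by eexists; first exact: Hx; rewrite !mulgA mulgV mul1g -mulgA mulgV mulg1.
Qed.

Lemma conj_set_closed (g : G) (H : Sub) : closed (conj_set g H).
Proof.
rewrite conj_setE; apply: closed_comp; last exact: closed_subgroup_closed.
have mulc (a b : G -> G) : continuous a -> continuous b ->
    continuous (fun x => (a x * b x)%g).
  move=> ca cb x.
  apply: (@continuous_comp _ _ _ (fun x => (a x, b x)) (fun x => x.1 * x.2)%g).
    by apply: cvg_pair => /=; [exact: ca|exact: cb].
  exact: mulg_continuous.
move=> x _; apply: (mulc _ _) => [|y]; last exact: cvg_cst.
by apply: mulc => y; [exact: cvg_cst|exact: cvg_id].
Qed.

Lemma conj_set_group (g : G) (H : Sub) : group_closed [in conj_set g H].
Proof.
have /group_closed_setP[H1 HB] := closed_subgroup_group H.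
apply/group_closed_setP; rewrite conj_setE; split=> /= [|x y Hx Hy].
  by rewrite mulg1 mulVg.
have := HB _ _ Hx Hy.
by rewrite !invMg invgK !mulgA -(mulgA _ g g^-1%g) mulgV mulg1.
Qed.

Definition conj_subgroup (g : G) (H : Sub) : Sub :=
  ClosedSubgroup (@conj_set_closed g H) (@conj_set_group g H).

End Chabauty.

Section Trivial.
Variable G : lcscGroupType.

Lemma trivial_subgroup_closed : closed [set 1%g : G].
Proof.
apply: accessible_closed_set1; apply: hausdorff_accessible.
exact: lcsc_hausdorff.
Qed.

Lemma trivial_subgroup_group : group_closed [in [set 1%g : G]].
Proof.
by apply/group_closed_setP; split=> // x y -> ->; rewrite /= mulgV.
Qed.

Definition trivial_subgroup : closed_subgroup G :=
  ClosedSubgroup trivial_subgroup_closed trivial_subgroup_group.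

End Trivial.
Arguments whole_subgroup : clear implicits.
Arguments trivial_subgroup : clear implicits.

(* Sub(G) with the Borel sigma-algebra of the Chabauty topology. *)
Definition borel_Sub (G : lcscGroupType) :=
  g_sigma_algebraType (@open (closed_subgroup G)).

(* g acts on Sub(G) by H |-> g H g^-1. *)
Definition IRS (R : realType) (G : lcscGroupType)
    (mu : probability (borel_Sub G) R) : Prop :=
  forall (g : G) (A : set (borel_Sub G)), measurable A ->
    mu (conj_subgroup g @^-1` A) = mu A.

Definition conj_invariant (G : lcscGroupType)
    (X : set (closed_subgroup G)) : Prop :=
  forall g : G, conj_subgroup g @` X = X.

Definition URS (G : lcscGroupType) (X : set (closed_subgroup G)) : Prop :=
  [/\ closed X, conj_invariant X, X !=set0 &
    forall Y : set (closed_subgroup G), Y `<=` X ->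
      closed Y -> conj_invariant Y -> Y !=set0 -> Y = X].

(* Main.v *)
Require Import Defs.
From HB Require Import structures.
From mathcomp Require Import all_boot all_order all_algebra all_fingroup.
From mathcomp Require Import all_solvable zify.

Set Implicit Arguments.
Unset Strict Implicit.
Unset Printing Implicit Defensive.

Import Order.TTheory GRing.Theory Num.Theory.

(** The field Q_p puts no constraint on the group. A permutation of a countable
    set can be realised by translating the disjoint balls p^-k + Z_p onto one
    another ([PL_embedding]), and a second countable totally disconnected
    locally compact group acts faithfully on the countable set of cosets of a
    countable basis of compact open subgroups. So it suffices to construct, for
    every sequence of finite groups K_n, a group G locally isomorphic to the
    product of the K_n, that has no IRS and no URS beyond the obvious ones.

    G is the increasing union of open subgroups V_n x W_n, where W_n is the
    product of the K_m for m >= n and V_n is a finite group; the group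
    D_n = V_n x K_n is embedded in V_(n+1), so that V_n x W_n = D_n x W_(n+1) is
    contained in V_(n+1) x W_(n+1). A closed subgroup H of G has a trace
    [level n H] in V_n, namely the image of its intersection with V_n x W_n.
    If H is not trivial, its trace in V_(n+1) contains a nontrivial element of
    D_n for all large n. If its trace in V_(n+1) contains D_n for infinitely
    many n, then H is dense, hence equal to G.

    The embeddings are chosen so that these two situations are hard to tell
    apart. V_(n+1) is the symmetric group of D x D x Z with D = D_n acting
    regularly on the first factor, and Z a large finite set. Each fibre
    {x} x D x Z carries an alternating group Q_x, and a nontrivial f in D moves
    it to another fibre, so that Q_x commutes with its conjugate by f. If a
    subgroup L contains a positive proportion of the conjugates of f by Q_x,
    then it contains all of Q_x, provided that Z is large enough
    ([dense_displaced_sub]). If L contains all the Q_x then it contains the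
    regular action of D on the second factor, which is conjugate to D by the
    exchange of the two factors.

    For an IRS the probability that H contains f is the average over Q_x of the
    probabilities that it contains a given conjugate of f, so up to a small
    probability H contains a conjugate of D as soon as it contains f; by
    invariance it then contains D itself ([stage_random]). The error tends to 0
    with n, so H is almost surely 1 or G ([IRS_two_points]). For a URS X that
    does not contain {1}, compactness gives a single n from which on the traces
    of all members of X meet D_m nontrivially. Then every conjugate of every
    member contains one of the finitely many nontrivial elements of D_m, and the
    pigeonhole principle takes the place of the averaging ([stage_confined]):
    every member of X is G ([limit_URS]). *)

(** * Dense sets of conjugates *)

Section Density.
Local Open Scope group_scope.

(** The core of P is trivial, so Q acts faithfully on the cosets of P; there are
    at most k ^ k self-maps of a set of at most k cosets. *)
Lemma simple_index_gt (gT : finGroupType) (Q P : {group gT}) (k : nat) :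
  simple Q -> P \proper Q -> (k ^ k < #|Q|)%N -> (k < #|Q : P|)%N.
Proof.
move=> sQ ltPQ; apply: contraLR; rewrite -!leqNgt => le_ik.
have core1 : gcore P Q = 1.
  have [_ /(_ _ (gcore_normal (proper_sub ltPQ))) [-> //|eqQ]] := simpleP _ sQ.
  by have := proper_subn ltPQ; rewrite -{1}eqQ gcore_sub.
pose S := rcosets P Q.
pose F g : {ffun {set gT} -> {set gT}} := [ffun A => if A \in S then A :* g else set0].
have injF : {in Q &, injective F}.
  move=> g h Qg Qh /ffunP eqF; apply/eqP; rewrite eq_mulgV1 -in_set1.
  rewrite -[[set 1]]/(1 : {set gT}) -core1 -astabRs_rcosets.
  apply/astabP => A SA; have := eqF A; rewrite !ffunE SA /= => eqA.
  rewrite actM; have -> : 'Rs%act A g = 'Rs%act A h by rewrite /= !rcosetE.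
  by rewrite -actM mulgV act1.
rewrite -(card_in_imset injF).
have subF : F @: Q \subset pffun_on set0 (mem S) (mem S).
  apply/subsetP => _ /imsetP[g Qg ->]; apply/pffun_onP; split.
    by apply/supportP => A; rewrite ffunE => /negbTE ->.
  move=> B /imageP[A SA ->]; rewrite ffunE SA.
  have /actsP/(_ _ Qg A) := actsRs_rcosets P Q.
  by rewrite /= rcosetE SA.
apply: leq_trans (subset_leq_card subF) _.
rewrite card_pffun_on -/(#|Q : P|).
have i0 : (0 < #|Q : P|)%N by apply: indexg_gt0.
have k0 : (0 < k)%N by apply: leq_trans le_ik.
by apply: (@leq_trans (k ^ #|Q : P|)%N); rewrite ?leq_exp2r ?leq_pexp2l.
Qed.

(** If s and t are such that f ^ s and f ^ t lie in L, then L contains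
    f ^ s * (f ^ t)^-1 = u * v, where u = s^-1 * t lies in Q and
    v = (s * t^-1) ^ f^-1 lies in a conjugate of Q that commutes with Q. The
    density hypothesis is used twice. First, the elements u generate Q, since
    otherwise the set T of these t would lie in a coset of a proper subgroup,
    and such subgroups have a large index. Second, two distinct elements u
    occur with the same v, since otherwise, for each w, the elements t of T such
    that w * t is in T would lie in a coset of the centraliser of w, and the sum
    of the orders of the centralisers is too small compared with #|T| ^ 2.
    By the second point Q :&: L is not trivial; by the first it is normalised by
    Q, as v centralises Q. *)
Lemma dense_displaced_sub (gT : finGroupType) (Q L : {group gT}) (f : gT) (N : nat) :
  simple Q -> ~~ abelian Q ->
  (forall P : {group gT}, P \proper Q -> (2 * N ^ 2 < #|Q : P|)%N) ->
  Q :^ f \subset 'C(Q) ->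
  (#|Q| <= N * #|[set t in Q | f ^ t \in L]%g|)%N -> Q \subset L.
Proof.
move=> sQ nabQ bigQ cQf; set T := [set t in Q | _] => dT.
have TQ t : t \in T -> t \in Q by rewrite inE => /andP[].
have N0 : (0 < N)%N by move: dT; case: (N) => //; rewrite mul0n leqNgt cardG_gt0.
pose g := f^-1.
have cg u v : u \in Q -> v \in Q -> commute u (v ^ g).
  move=> Qu Qv; have E : commute (u ^ f) v.
    by apply: (centsP cQf) => //; rewrite memJ_conjg.
  by apply: (can_inj (conjgK f)); rewrite /g /= conjMg [RHS]conjMg conjgKV.
have memL s t : s \in T -> t \in T -> (s^-1 * t) * (s * t^-1) ^ g \in L.
  rewrite !inE => /andP[Qs Ls] /andP[Qt Lt].
  have -> : s^-1 * t * (s * t^-1) ^ g = f ^ s * (f ^ t)^-1.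
    have -> : f ^ s * (f ^ t)^-1 = s^-1 * ((s * t^-1) ^ g * t).
      by rewrite /g /conjg !invMg !invgK !mulgA.
    by rewrite -mulgA; congr (_ * _); apply: cg; rewrite ?groupM ?groupV.
  by rewrite groupM ?groupV.
clearbody T g.
pose P := [set u in Q | [exists v in Q, u * v ^ g \in L]].
have gP : group_set P.
  apply/group_setP; split.
    rewrite inE group1; apply/exists_inP; exists 1; rewrite ?group1 //.
    by rewrite conj1g mulg1 group1.
  move=> u u'; rewrite !inE => /andP[Qu /exists_inP[v Qv Luv]] /andP[Qu' /exists_inP[v' Qv' Luv']].
  rewrite groupM //; apply/exists_inP; exists (v * v'); first exact: groupM.
  have -> : u * u' * (v * v') ^ g = (u * v ^ g) * (u' * v' ^ g).
    move: (cg u' v Qu' Qv); rewrite conjMg; move: (v ^ g) (v' ^ g) => a b C.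
    by rewrite -!mulgA; congr (_ * _); rewrite mulgA C mulgA.
  exact: groupM.
have PQ : P \subset Q by apply/subsetP => u; rewrite inE => /andP[].
have Q0 := cardG_gt0 Q.
have T0 : (0 < #|T|)%N by move: dT; case: (#|T|) => //; rewrite muln0 leqNgt Q0.
(* T lies in a single coset of P, so the index of P is at most N. *)
have PE : P = Q.
  apply/eqP; rewrite eqEproper PQ; apply/negP => /(bigQ (group gP)).
  apply/negP; rewrite -leqNgt.
  have [s Ts] := card_gt0P T0.
  have TP : (#|T| <= #|P|)%N.
    rewrite -(card_lcoset P s); apply/subset_leq_card/subsetP => t Tt.
    rewrite mem_lcoset inE groupM ?groupV ?TQ //=.
    apply/exists_inP; exists (s * t^-1); last exact: memL.
    by rewrite groupM ?groupV ?TQ.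
  have : (#|Q| <= N * #|P|)%N by apply: leq_trans dT _; rewrite leq_mul2l TP orbT.
  rewrite -(Lagrange (PQ : group gP \subset Q)) /= mulnC leq_pmul2r ?(leq_trans T0) // => le.
  by apply: leq_trans le _; nia.
(* Two elements of L with the same v: their quotient lies in Q. *)
have [u1 [u2 [w [Qu1 Qu2 Qw L1 [L2 u12]]]]] : exists u1 u2 w,
    [/\ u1 \in Q, u2 \in Q, w \in Q, u1 * w ^ g \in L & u2 * w ^ g \in L /\ u1 != u2].
  apply: boolp.contrapT => no.
  (* For s = w * t the element u is (w^-1) ^ t and v depends on w only; so t
     is determined by w up to the centraliser of w. *)
  have CQ1 w : w \in Q -> (#|[set t in T | w * t \in T]%g| <= #|'C_Q[w]|)%N.
    move=> Qw; set Tw := [set t in T | _].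
    have [->|/set0Pn[t0 Tt0]] := eqVneq Tw set0; first by rewrite cards0.
    rewrite -(card_rcoset 'C_Q[w] t0); apply/subset_leq_card/subsetP => t Tt.
    rewrite mem_rcoset inE.
    have conjE r : r \in Tw -> (w * r)^-1 * r * w ^ g \in L /\ r \in Q.
      rewrite inE => /andP[Tr Twr]; have := memL _ _ Twr Tr.
      by rewrite mulgK; split=> //; exact: TQ.
    have [Lt Qt] := conjE _ Tt; have [Lt0 Qt0] := conjE _ Tt0.
    rewrite groupM ?groupV //=.
    have E : (w * t)^-1 * t = (w * t0)^-1 * t0.
      apply/eqP/negPn/negP => ne; apply: no.
      exists ((w * t)^-1 * t), ((w * t0)^-1 * t0), w.
      have QV r : r \in Q -> (w * r)^-1 * r \in Q.
        by move=> Qr; rewrite groupM // groupV groupM.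
      by split=> //; [exact: QV|exact: QV].
    apply/cent1P; rewrite /commute.
    have : w ^ t = w ^ t0.
      apply: invg_inj; rewrite /conjg !invMg !invgK.
      by move: E; rewrite !invMg.
    move/(congr1 (fun z => z ^ t0^-1)); rewrite -!conjgM mulgV conjg1 => /conjg_fixP.
    by move=> /commgP.
  have sumT : (#|T| ^ 2 = \sum_(w in Q) #|[set t in T | w * t \in T]%g|)%N.
    rewrite -mulnn -cardsX.
    rewrite -sum1_card (partition_big (fun x => x.1 * x.2^-1) (mem Q)) /=; last first.
      by case=> s t /setXP[/= /TQ Qs /TQ Qt]; rewrite groupM ?groupV.
    apply: eq_bigr => w Qw; rewrite sum1_card.
    have injh : injective (fun t : gT => (w * t, t)) by move=> ? ? [].
    rewrite -(card_imset _ injh); apply: eq_card => -[s t].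
    apply/andP/imsetP => /= [[/setXP[/= Ts Tt] /eqP<-]|[t' Tt' [-> ->]]].
      by exists t; rewrite ?inE mulgKV ?Tt ?Ts.
    move: Tt'; rewrite inE => /andP[Tt' Twt'].
    by split; [exact/setXP | rewrite mulgK].
  have big1 : (2 * N ^ 2 < #|Q|)%N.
    have /bigQ : 1%G \proper Q.
      rewrite properE sub1G /=; apply: contra nabQ => /trivgP ->; exact: abelian1.
    by rewrite indexg1.
  have bigC w : w \in Q -> w != 1 -> (2 * N ^ 2 * #|'C_Q[w]| <= #|Q|)%N.
    move=> Qw w1; have pr : ('C_Q[w])%G \proper Q.
      rewrite properE subsetIl /=; apply/negP => QC.
      have wZ : w \in 'Z(Q).
        rewrite inE Qw; apply/centP => x Qx; apply/commute_sym/cent1P.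
        by move/subsetP: QC => /(_ x Qx); rewrite inE => /andP[].
      have [_ /(_ _ (center_normal Q)) [Z1|ZQ]] := simpleP _ sQ.
        by move: wZ; rewrite Z1 inE (negPf w1).
      by move: nabQ; rewrite -[abelian Q]/(Q \subset 'C(Q)) -{1}ZQ subsetIr.
    rewrite -(Lagrange (subsetIl Q 'C[w])) mulnC leq_mul2l.
    by rewrite (ltnW (bigQ _ pr)) orbT.
  have bound : (2 * N ^ 2 * #|T| ^ 2 < 2 * #|Q| ^ 2)%N.
    have QQ : (#|Q| ^ 2 = #|Q| * #|Q|)%N by rewrite mulnn.
    rewrite sumT (bigD1 1) //= mulnDr QQ; move: bigC big1.
    move: (2 * N ^ 2)%N => k bigC big1.
    rewrite mul2n -addnn -addSn leq_add //.
      apply: (@leq_ltn_trans (k * #|Q|)%N); last by rewrite ltn_pmul2r.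
      by rewrite leq_mul2l (leq_trans (CQ1 _ (group1 Q))) ?orbT // subset_leq_card ?subsetIl.
    rewrite big_distrr /= -{1}sum1_card big_distrl /=.
    rewrite [leqRHS](bigD1 1) //=; apply: leq_trans (leq_addl _ _).
    apply: leq_sum => w /andP[Qw w1]; rewrite mul1n (leq_trans _ (bigC w Qw w1)) //.
    by rewrite leq_mul2l CQ1 // orbT.
  have : (#|Q| ^ 2 <= (N * #|T|) ^ 2)%N by rewrite leq_exp2r.
  by rewrite expnMn; move: bound; lia.
(* Conjugation by u on Q is conjugation by u * v, which preserves L. *)
have nLQ : Q :&: L <| Q.
  rewrite /normal subsetIl; apply/subsetP => u Qu; rewrite inE.
  apply/subsetP => _ /imsetP[x /setIP[Qx Lx] ->].
  rewrite inE groupJ //=.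
  have : u \in P by rewrite PE.
  rewrite inE => /andP[_ /exists_inP[v Qv Luv]].
  have -> : x ^ u = x ^ (u * v ^ g).
    rewrite conjgM; apply/esym/conjg_fixP/commgP/cg => //.
    by rewrite groupJ.
  by rewrite groupJ.
have [_ /(_ _ nLQ) [Q1|QE]] := simpleP _ sQ; last by rewrite -QE subsetIr.
have : u1 * u2^-1 \in Q :&: L.
  rewrite inE groupM ?groupV //=.
  have -> : u1 * u2^-1 = (u1 * w ^ g) * (u2 * w ^ g)^-1 by rewrite invMg mulgA mulgK.
  by rewrite groupM ?groupV.
by rewrite Q1 inE -eq_mulgV1 (negPf u12).
Qed.

End Density.

(** Here w L is the probability that a random subgroup is L. *)
Section Weights.
Local Open Scope group_scope.
Variables (R : realFieldType) (gT : finGroupType) (w : {set gT} -> R).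
Hypothesis w_ge0 : forall L, (0 <= w L)%R.
Hypothesis w_conj : forall L c, w (L :^ c) = w L.
Hypothesis w_group : forall L, w L != 0%R -> group_set L.

(** The weights and the condition Q \subset L are invariant under conjugation by
    Q. Hence the sum on the left is the average over t in Q of the weight of the
    L that contain f ^ t but not Q. If the weight of such an L is not 0 then L is
    a subgroup, and by dense_displaced_sub the proportion of the t in Q such
    that L contains f ^ t is less than 1 / N. *)
Lemma sum_displaced (Q : {group gT}) (f : gT) (N : nat) :
  simple Q -> ~~ abelian Q ->
  (forall P : {group gT}, P \proper Q -> (2 * N ^ 2 < #|Q : P|)%N) ->
  Q :^ f \subset 'C(Q) ->
  (N%:R * (\sum_(L : {set gT} | (f \in L) && ~~ (Q \subset L)) w L)
     <= \sum_(L : {set gT}) w L)%R.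
Proof.
move=> sQ nabQ bigQ cQf.
have Q0 : (0 < #|Q|%:R :> R)%R by rewrite ltr0n cardG_gt0.
rewrite -(ler_pM2l Q0) mulrCA.
have -> : (#|Q|%:R * (\sum_(L : {set gT} | (f \in L) && ~~ (Q \subset L)) w L)
   = \sum_(L : {set gT} | ~~ (Q \subset L)) (#|[set t in Q | f ^ t \in L]%g|%:R * w L))%R.
  transitivity (\sum_(c in Q) \sum_(L : {set gT} | (f ^ c \in L)%g && ~~ (Q \subset L)) w L)%R.
    rewrite mulr_natl -sumr_const; apply: eq_bigr => c Qc.
    rewrite (reindex_inj (can_inj (conjsgKV c))) /=.
    apply: eq_big => [L|L _]; last by rewrite w_conj.
    by rewrite mem_conjgV -(sub_conjg Q L c) conjGid.
  under eq_bigr do rewrite big_mkcondl /=.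
  rewrite exchange_big /=; apply: eq_bigr => L _.
  rewrite -big_mkcondr /= sumr_const mulr_natl; congr (_ *+ _)%R.
  by apply: eq_card => c; rewrite inE.
rewrite mulr_sumr mulr_sumr.
rewrite [leRHS](bigID (fun L : {set gT} => Q \subset L)) /= ler_wpDl //.
  by apply: sumr_ge0 => L _; rewrite mulr_ge0.
apply: ler_sum => L nQL; rewrite mulrA -natrM.
have [->|/w_group gL] := eqVneq (w L) 0%R; first by rewrite !mulr0.
rewrite ler_wpM2r // ler_nat leqNgt; apply: contra nQL => /ltnW.
exact: (@dense_displaced_sub _ Q (Group gL)).
Qed.

End Weights.

(** * Finite groups in which a given group is hard to avoid *)

Section Stage.
Local Open Scope group_scope.
Variables (D : finGroupType) (m : nat).

(** The group D acts regularly on both of its copies in the set of the triples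
    (x, (y, z)). The first action permutes the fibres, the second preserves
    them, and the exchange of x and y conjugates one to the other. The factor
    bool makes the second action even; the factor 'I_m makes the fibres large. *)
Definition fibre_type := (D * ('I_m * bool))%type.
Definition stage_point := (D * fibre_type)%type.

Definition shift_base_fun (d : D) (x : stage_point) : stage_point := (x.1 * d, x.2).
Lemma shift_base_inj d : injective (shift_base_fun d).
Proof. by move=> [x y] [x' y'] [/mulIg -> ->]. Qed.
Definition shift_base d : {perm stage_point} := perm (@shift_base_inj d).

Definition shift_fibre_fun (d : D) (y : fibre_type) : fibre_type := (y.1 * d, y.2).
Lemma shift_fibre_inj d : injective (shift_fibre_fun d).
Proof. by move=> [x y] [x' y'] [/mulIg -> ->]. Qed.
Definition shift_fibre d : {perm fibre_type} := perm (@shift_fibre_inj d).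

Definition on_fibres_fun (A : pred D) (s : {perm fibre_type}) (x : stage_point) : stage_point :=
  if A x.1 then (x.1, s x.2) else x.
Lemma on_fibres_inj A s : injective (on_fibres_fun A s).
Proof.
move=> [x y] [x' y']; rewrite /on_fibres_fun /=.
have [->|ne] := eqVneq x x'; first by case: ifP => _ [] => [/perm_inj|] ->.
by case: ifP; case: ifP => _ _ [/eqP]; rewrite (negPf ne).
Qed.
Definition on_fibres A s : {perm stage_point} := perm (@on_fibres_inj A s).

Definition swap_fun (x : stage_point) : stage_point := (x.2.1, (x.1, x.2.2)).
Lemma swap_inj : injective swap_fun.
Proof. by move=> [x [y z]] [x' [y' z']] [-> -> ->]. Qed.
Definition swap : {perm stage_point} := perm swap_inj.

Lemma shift_baseM : {morph shift_base : d e / d * e}.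
Proof. by move=> d e; apply/permP => x; rewrite permM !permE /shift_base_fun /= mulgA. Qed.

Lemma on_fibresM A : {morph on_fibres A : s t / s * t}.
Proof.
move=> s t; apply/permP => x; rewrite permM !permE /on_fibres_fun /=.
by case: ifP => Ax /=; rewrite Ax ?permM.
Qed.

Canonical on_fibres_morphism A := @Morphism _ _ setT (on_fibres A) (in2W (@on_fibresM A)).

Definition fibre_alt (x : D) := on_fibres (pred1 x) @* 'Alt_fibre_type.
Canonical fibre_alt_group x := Eval hnf in [group of fibre_alt x].

Lemma on_fibre_injm x : 'injm (on_fibres (pred1 x)).
Proof.
apply/injmP => s t _ _ /permP E; apply/permP => y.
by have := E (x, y); rewrite !permE /on_fibres_fun /= eqxx => -[].
Qed.

Lemma on_fibres_commute x x' s t : x != x' ->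
  commute (on_fibres (pred1 x) s) (on_fibres (pred1 x') t).
Proof.
move=> xx'; apply/permP => -[z y]; rewrite !permM !permE /on_fibres_fun /=.
have [->|zx] := eqVneq z x; first by rewrite /= (negPf xx') /= eqxx.
by case: (z == x') => /=; rewrite (negPf zx).
Qed.

Lemma on_fibres_shift x s d :
  on_fibres (pred1 x) s ^ shift_base d = on_fibres (pred1 (x * d)) s.
Proof.
rewrite conjgE; apply/(canLR (mulKg _))/permP => -[z y].
rewrite !permM !permE /on_fibres_fun /shift_base_fun /= (inj_eq (mulIg d)).
by case: ifP.
Qed.

(** Permutations of two different fibres commute. *)
Lemma fibre_alt_shift x d : d != 1 ->
  fibre_alt x :^ shift_base d \subset 'C(fibre_alt x).
Proof.
move=> d1; apply/centsP => _ /imsetP[_ /morphimP[s _ _ ->] ->] _ /morphimP[t _ _ ->].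
rewrite on_fibres_shift; apply: on_fibres_commute.
by rewrite -{2}(mulg1 x) (inj_eq (mulgI x)).
Qed.

(** The boolean coordinate cuts the fibre into two halves. The permutations
    induced on them are conjugate, so their signs cancel. *)
Lemma shift_fibre_even d : shift_fibre d \in 'Alt_fibre_type.
Proof.
pose half_fun (y : fibre_type) : fibre_type := if y.2.2 then (y.1 * d, y.2) else y.
have half_inj : injective half_fun.
  rewrite /half_fun => -[x [i []]] [x' [i' []]] //=.
    by move=> [/mulIg -> ->].
pose flip_fun (y : fibre_type) : fibre_type := (y.1, (y.2.1, ~~ y.2.2)).
have flip_inj : injective flip_fun.
  by move=> [x [i b]] [x' [i' b']] [-> -> /negb_inj ->].
pose half := perm half_inj; pose flip := perm flip_inj.
have -> : shift_fibre d = half * half ^ flip.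
  rewrite conjgE; apply/permP => -[x [i b]]; rewrite !permM.
  have flipV : flip^-1 = flip.
    apply/permP => y; apply: (@perm_inj _ flip); rewrite permKV.
    by rewrite !permE /flip_fun /= negbK; case: y => ? [].
  rewrite flipV !permE /half_fun /flip_fun /shift_fibre_fun /=.
  by case: b.
by rewrite Alt_even odd_permM odd_permJ addbb.
Qed.

Lemma on_fibresU A x s : ~~ A x ->
  on_fibres (fun z => A z || (z == x)) s = on_fibres A s * on_fibres (pred1 x) s.
Proof.
move=> Ax; apply/permP => -[z y]; rewrite permM !permE /on_fibres_fun /=.
have [->|zx] := eqVneq z x; first by rewrite orbT (negPf Ax) /= eqxx.
by rewrite orbF; case: (A z) => /=; rewrite (negPf zx).
Qed.

(** The simultaneous action of s on all fibres is a product over the fibres. *)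
Lemma on_all_fibres (L : {group {perm stage_point}}) s : s \in 'Alt_fibre_type ->
  (forall x, fibre_alt x \subset L) -> on_fibres predT s \in L.
Proof.
move=> Es subL.
suff H (r : seq D) : uniq r -> on_fibres (fun z => z \in r) s \in L.
  have -> : on_fibres predT s = on_fibres (fun z => z \in enum D) s.
    by apply/permP => x; rewrite !permE /on_fibres_fun /= mem_enum.
  exact/H/enum_uniq.
elim: r => [_|x r IH /= /andP[xr ur]].
  suff -> : on_fibres (fun z => z \in [::]) s = 1 by rewrite group1.
  by apply/permP => x; rewrite !permE /on_fibres_fun.
have -> : on_fibres (fun z => z \in x :: r) s = on_fibres (fun z => (z \in r) || (z == x)) s.
  by apply/permP => z; rewrite !permE /on_fibres_fun /= inE orbC.
rewrite (on_fibresU (A := fun z => z \in r)) //= groupM ?IH //.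
by apply: (subsetP (subL x)); apply/morphimP; exists s; rewrite ?in_setT.
Qed.

Lemma shift_base_swap d : shift_base d ^ swap = on_fibres predT (shift_fibre d).
Proof.
rewrite conjgE; apply/(canLR (mulKg _))/permP => -[x [y z]].
by rewrite !permM !permE /on_fibres_fun /swap_fun /shift_base_fun /= !permE.
Qed.

End Stage.

Section StageTheorems.
Local Open Scope group_scope.
Variables (D : finGroupType) (n : nat).

(** The proportion 1 / stage_bound is what remains of 1 / n.+1 after a union
    bound over the elements of D and another one over the fibres. *)
Definition stage_bound : nat := (#|D| ^ 2 * n.+1)%N.
(** This makes the alternating group of a fibre simple, of order above k ^ k,
    hence without proper subgroups of index at most k. *)
Definition stage_mult : nat := (let k := 2 * stage_bound ^ 2 in k ^ k + 5)%N.

Definition stage : finGroupType := {perm stage_point D stage_mult}.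
Definition stage_emb : D -> stage := @shift_base D stage_mult.

Lemma stage_embM : {morph stage_emb : d e / d * e}.
Proof. exact: shift_baseM. Qed.

Let base_point : fibre_type D stage_mult.
Proof.
split; [exact: 1 | split; [|exact: true]].
by apply: (@Ordinal _ 0); rewrite /stage_mult addnS.
Defined.

Lemma stage_emb_inj : injective stage_emb.
Proof.
move=> d e /permP /(_ (1, base_point)).
by rewrite !permE /shift_base_fun /= !mul1g => -[].
Qed.

Let Q := @fibre_alt_group D stage_mult.

Lemma fibre_type_large : (4 < #|{: fibre_type D stage_mult}|)%N /\
  (stage_mult <= #|{: fibre_type D stage_mult}|)%N.
Proof.
have le : (stage_mult <= #|{: fibre_type D stage_mult}|)%N.
  rewrite !card_prod card_ord card_bool.
  have : (0 < #|D|)%N by rewrite -cardsT cardG_gt0.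
  by case: #|D| => // d _; nia.
by split=> //; apply: leq_trans le; rewrite /stage_mult addnS ltnS leq_addl.
Qed.

Lemma fibre_isog x : 'Alt_(fibre_type D stage_mult) \isog Q x.
Proof. by apply: sub_isog; [exact: subsetT | exact: on_fibre_injm]. Qed.

Lemma fibre_alt_simple x : simple (Q x).
Proof.
have [gt4 _] := fibre_type_large.
by rewrite -(isog_simple (fibre_isog x)) simple_Alt5.
Qed.

Lemma fibre_alt_nonabelian x : ~~ abelian (Q x).
Proof.
have [gt4 _] := fibre_type_large.
rewrite -(isog_abelian (fibre_isog x)); apply/negP => /abelian_sol.
by rewrite solvable_AltF.
Qed.

Lemma fibre_alt_index x (P : {group stage}) : P \proper Q x ->
  (2 * stage_bound ^ 2 < #|Q x : P|)%N.
Proof.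
move=> ltPQ; apply: (simple_index_gt (fibre_alt_simple x) ltPQ).
rewrite -(card_isog (fibre_isog x)).
have [gt4 le] := fibre_type_large.
have := @card_Alt (fibre_type D stage_mult) (ltnW (ltnW (ltnW gt4))).
move: gt4 le; case: #|{: fibre_type _ _}| => // c; rewrite ltnS => c4 le.
have c2 : (2 <= c`!)%N.
  case: c c4 {le} => // c' c4; rewrite factS.
  by apply: leq_trans (leq_mul c4 (fact_gt0 _)).
rewrite factS => E; apply: leq_trans (_ : (c.+1 <= _)%N); last first.
  by rewrite -(leq_pmul2l (isT : (0 < 2)%N)) E mulnC leq_mul2l c2 orbT.
by apply: leq_trans le; rewrite /stage_mult addnS ltnS leq_addr.
Qed.

Lemma stage_swap (L : {group stage}) d : (forall x, Q x \subset L) ->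
  stage_emb d ^ (swap D stage_mult) \in L.
Proof.
move=> subL; rewrite shift_base_swap; apply: on_all_fibres => //.
exact: shift_fibre_even.
Qed.

Lemma cardD_gt0 : (0 < #|D|)%N.
Proof. by rewrite -cardsT cardG_gt0. Qed.

(** Each conjugate of L by Q x contains one of the #|D|.-1 nontrivial elements
    of D, so some f has at least #|Q x| / #|D| of its conjugates by Q x in L.
    Hence L contains all the Q x and the conjugate of D by the swap. The swap
    is undone by applying this to a conjugate of L. *)
Lemma stage_confined (S : {set stage} -> Prop) :
  (forall L c, S L -> S (L :^ c)) -> (forall L, S L -> group_set L) ->
  (forall L, S L -> exists2 f, f != 1 & stage_emb f \in L) ->
  forall L, S L -> forall d, stage_emb d \in L.
Proof.
move=> SJ Sg Sf L SL d.
rewrite -(conjgK (swap D stage_mult) (stage_emb d)) -mem_conjg.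
have SLs := SJ _ (swap D stage_mult) SL; move: (L :^ _) SLs => {SL}L SL.
pose LG := Group (Sg _ SL); rewrite -[L]/(gval LG).
apply: stage_swap => x.
pose T f := [set t in Q x | stage_emb f ^ t \in LG].
have cov : (#|Q x| <= \sum_(f : D | f != 1%g) #|T f|)%N.
  rewrite -[leqLHS]sum1_card.
  have -> : (\sum_(f : D | f != 1%g) #|T f| =
      \sum_(f : D | f != 1%g) \sum_(t in Q x) (stage_emb f ^ t \in LG)%g)%N.
    apply: eq_bigr => f _; rewrite -sum1_card [RHS]big_mkcond [LHS]big_mkcond /=.
    by apply: eq_bigr => t _; rewrite inE; case: ifP; case: (_ \in LG); case: (_ \in Q x).
  rewrite exchange_big /=; apply: leq_sum => t Qt.
  have [f f1 Lf] := Sf _ (SJ _ t^-1 SL).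
  rewrite (bigD1 f) //= -[leqLHS]addn0 leq_add // lt0b.
  by rewrite -mem_conjgV.
have [f f1 dT] : exists2 f, f != 1 & (#|Q x| <= #|D| * #|T f|)%N.
  apply/exists_inP; move: cov; apply: contraLR => /exists_inPn no.
  rewrite -ltnNge -(ltn_pmul2l cardD_gt0).
  have [f0 f01 _] := Sf _ SL.
  rewrite big_distrr /= (leq_ltn_trans (n := (\sum_(f : D | f != 1%g) #|Q x|.-1)%N)) //.
    apply: leq_sum => f f1; have := no f f1; rewrite -ltnNge.
    by case: #|Q x|.
  rewrite sum_nat_const.
  have lt1 : (#|[pred f : D | f != 1%g]| <= #|D|)%N by apply: max_card.
  have Q0 := cardG_gt0 (Q x); have D0 := cardD_gt0.
  apply: (@leq_ltn_trans (#|D| * #|Q x|.-1)%N); first by rewrite leq_mul2r lt1 orbT.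
  by rewrite ltn_pmul2l // prednK.
apply: (@dense_displaced_sub stage (Q x) LG (stage_emb f) stage_bound);
  [exact: fibre_alt_simple | exact: fibre_alt_nonabelian | exact: fibre_alt_index
  | exact: fibre_alt_shift |].
apply: leq_trans dT _; rewrite leq_mul2r; apply/orP; right.
by rewrite /stage_bound; have := cardD_gt0; nia.
Qed.

(** Fix f. By sum_displaced and a union bound over the fibres, the subgroups
    that contain f but not the conjugate of D by the swap have total weight at
    most #|D| / stage_bound. The subgroups that contain D all contain f and
    weigh as much as those that contain its conjugate; so the same bound holds
    for the subgroups that contain f but not D. It remains to sum over f. *)
Lemma stage_random (R : realFieldType) (w : {set stage} -> R) :
  (forall L, (0 <= w L)%R) -> (forall L c, w (L :^ c) = w L) ->
  (forall L, w L != 0%R -> group_set L) -> (\sum_L w L = 1)%R ->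
  (\sum_(L : {set stage} | [exists f : D, (f != 1%g) && (stage_emb f \in L)] &&
             ~~ [forall d : D, stage_emb d \in L]) w L <= n.+1%:R^-1)%R.
Proof.
move=> w0 wJ wg w1.
pose allI (L : {set stage}) := [forall d : D, stage_emb d \in L].
pose allJ (L : {set stage}) := [forall d : D, stage_emb d ^ swap D stage_mult \in L].
have N0 : (0 < stage_bound%:R :> R)%R.
  by rewrite ltr0n /stage_bound muln_gt0 expn_gt0 cardD_gt0.
have le_w (P P' : pred {set stage}) : (forall L, w L != 0%R -> P L -> P' L) ->
    (\sum_(L : {set stage} | P L) w L <= \sum_(L : {set stage} | P' L) w L)%R.
  move=> PP'; rewrite [leLHS]big_mkcond [leRHS]big_mkcond /=; apply: ler_sum => L _.
  have [->|wL] := eqVneq (w L) 0%R; first by rewrite !if_same.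
  by case: ifP => [/(PP' _ wL) ->|_] //; case: ifP.
have wU (P : pred D) (B : D -> pred {set stage}) :
    (\sum_(L : {set stage} | [exists i, P i && B i L]) w L
       <= \sum_(i | P i) \sum_(L : {set stage} | B i L) w L)%R.
  rewrite (exchange_big_dep predT) //= [leLHS]big_mkcond /=; apply: ler_sum => L _.
  have ge0 : (0 <= \sum_(i | P i && B i L) w L)%R by apply: sumr_ge0.
  case: ifP => // /existsP[i Pi]; rewrite (bigD1 i) //= ler_wpDr //.
  exact: sumr_ge0.
have bound f : f != 1 ->
    (\sum_(L : {set stage} | (stage_emb f \in L) && ~~ allI L) w L <= #|D|%:R / stage_bound%:R)%R.
  move=> f1.
  have -> : (\sum_(L : {set stage} | (stage_emb f \in L) && ~~ allI L) w L =
      \sum_(L : {set stage} | stage_emb f \in L) w L - \sum_(L : {set stage} | allJ L) w L)%R.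
    rewrite [in RHS](bigID allI) /=.
    have -> : (\sum_(L : {set stage} | allJ L) w L = \sum_(L : {set stage} | allI L) w L)%R.
      rewrite (reindex_inj (can_inj (conjsgK (swap D stage_mult)))) /=.
      apply: eq_big => [L|L _]; last exact: wJ.
      by apply: eq_forallb => d; rewrite memJ_conjg.
    have -> : (\sum_(L : {set stage} | (stage_emb f \in L) && allI L) w L =
        \sum_(L : {set stage} | allI L) w L)%R.
      apply: eq_bigl => L; apply/andP/idP => [[]//|aL]; split=> //.
      exact: (forallP aL).
    by rewrite addrAC subrr add0r.
  rewrite (bigID allJ) /= addrAC.
  apply: (@le_trans _ _ (\sum_(L : {set stage} | (stage_emb f \in L) && ~~ allJ L) w L)%R).
    by rewrite -[leRHS]add0r lerD2r subr_le0; apply: le_w => L _ /andP[].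
  apply: (@le_trans _ _ (\sum_(L : {set stage} | [exists x : D,
      predT x && ((stage_emb f \in L) && ~~ (Q x \subset L))]) w L)%R).
    apply: le_w => L wL /andP[fL nL]; apply: contraR nL => /existsPn no.
    apply/forallP => d; apply: (stage_swap (L := Group (wg _ wL))) => x.
    by have := no x; rewrite fL /= negbK.
  apply: le_trans (wU _ _) _.
  rewrite -sum1_card natr_sum mulr_suml; apply: ler_sum => x _.
  rewrite ler_pdivlMr // mulrC -[leRHS]w1.
  apply: sum_displaced => //; [exact: fibre_alt_simple | exact: fibre_alt_nonabelian
    | exact: fibre_alt_index | exact: fibre_alt_shift].
apply: (@le_trans _ _ (\sum_(L : {set stage} | [exists f : D,
    (f != 1%g) && ((stage_emb f \in L) && ~~ allI L)]) w L)%R).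
  apply: le_w => L _ /andP[/existsP[f /andP[f1 fL]] nL].
  by apply/existsP; exists f; rewrite f1 fL.
apply: le_trans (wU _ _) _; apply: (le_trans (ler_sum _ bound)).
rewrite sumr_const -[leLHS]mulr_natl mulrA -natrM ler_pdivrMr //.
rewrite ler_pdivlMl ?ltr0n // -natrM ler_nat /stage_bound mulnC leq_mul2r -mulnn.
by rewrite leq_mul2r max_card !orbT.
Qed.

End StageTheorems.

From mathcomp Require Import finmap.
From mathcomp Require Import all_classical all_reals all_analysis.

Local Open Scope classical_set_scope.
Local Open Scope quotient_scope.

(** * Balls in the field of p-adic numbers *)

Section Padic.
Local Open Scope ring_scope.
Variables (p : nat) (p_prime : prime p).
Local Notation Zp := (padic_int p_prime).
Local Notation Qp := (padic p_prime).
Local Notation "z %:F" := (@FracField.tofrac Zp z).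

Let p_gt0 n : (0 < p ^ n)%N.
Proof. by rewrite expn_gt0 prime_gt0. Qed.

Lemma residueD (x y : Zp) n : (x + y) n = ((x n + y n) %% p ^ n)%N.
Proof. by []. Qed.

Lemma residueM (x y : Zp) n : (x * y) n = ((x n * y n) %% p ^ n)%N.
Proof. by []. Qed.

Lemma residue_nat (a n : nat) : (a%:R : Zp) n = (a %% p ^ n)%N.
Proof.
elim: a => [|a IH]; first by rewrite mod0n.
by rewrite -addn1 natrD residueD IH -[(1%:R : Zp) n]/(1 %% p ^ n)%N modnDm.
Qed.

Lemma dvd_residue (x : Zp) n : x n = 0%N -> exists y : Zp, x = p%:R ^+ n * y.
Proof.
move=> xn0.
have dvd m : (p ^ n %| x (n + m))%N by rewrite /dvdn -(residue_le x (leq_addr m n)) xn0.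
have coh : padic_coherent p (fun m => x (n + m)%N %/ p ^ n)%N.
  move=> m; rewrite modn_divl -expnD addnC [(m + n)%N]addnC.
  by rewrite -(residue_le x) // leq_add2l.
exists (PadicInt p_prime coh); apply: padic_intP => m.
rewrite -natrX residueM residue_nat modnMml /= mulnC divnK // .
by rewrite -(residue_le x) // leq_addl.
Qed.

Lemma residue_eq (x y : Zp) n : x n = y n -> exists z : Zp, x = y + p%:R ^+ n * z.
Proof.
move=> xy; have [|z zE] := @dvd_residue (x - y) n; last first.
  by exists z; rewrite -zE addrC subrK.
rewrite residueD -[(- y) n]/((p ^ n - y n) %% p ^ n)%N modnDmr xy subnKC ?modnn //.
exact/ltnW/residue_lt.
Qed.

(** Euler's theorem provides an inverse modulo each p ^ n. *)
Lemma padic_unit_residue (x : Zp) : x 1%N <> 0%N -> exists y : Zp, y * x = 1.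
Proof.
move=> x1.
have cop n : coprime (x n) (p ^ n).
  case: n => [|n]; first by rewrite coprimen1.
  rewrite coprime_sym coprime_pexpl // prime_coprime //.
  apply/negP => px; apply: x1.
  by rewrite (residue_le x (ltn0Sn n)) expn1; apply/eqP.
pose inv n := (x n ^ (totient (p ^ n)).-1 %% p ^ n)%N.
have invP n : (inv n * x n = 1 %[mod p ^ n])%N.
  rewrite /inv modnMml -expnSr prednK ?totient_gt0 //.
  exact: Euler_exp_totient.
have coh : padic_coherent p inv.
  move=> n; rewrite -[LHS]modn_mod.
  have E1 : (inv n.+1 * x n = 1 %[mod p ^ n])%N.
    have d : (p ^ n %| p ^ n.+1)%N by rewrite dvdn_exp2l.
    rewrite (residue_coherent x n) modnMmr -(modn_dvdm _ d) invP modn_dvdm //.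
  transitivity ((inv n * (inv n.+1 * x n)) %% p ^ n)%N.
    by rewrite -modnMmr E1 modnMmr muln1.
  by rewrite mulnCA -modnMmr invP modnMmr muln1.
exists (PadicInt p_prime coh); apply: padic_intP => n.
by rewrite residueM /= invP.
Qed.

Lemma padic_int_factor (x : Zp) : x != 0 ->
  exists n (y z : Zp), x = p%:R ^+ n * y /\ z * y = 1.
Proof.
move=> x0; have [n0 xn0] := padic_neq0 x0.
have [n xn ltn] := ex_minnP (ex_intro (fun n => x n != 0%N) n0 xn0).
case: n xn ltn => [|n] xn min.
  by move: xn; have := residue_lt x 0; rewrite expn0 ltnS leqn0 => ->.
have [|y xE] := @dvd_residue x n.
  by apply/eqP/negPn/negP => /min; rewrite ltnn.
have [|z zy] := @padic_unit_residue y; last by exists n, y, z.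
move=> y1; have [y' yE] := dvd_residue y1.
move: xn; rewrite xE yE mulrA -exprSr -natrX residueM residue_nat modnn.
by rewrite mul0n mod0n.
Qed.

Lemma tofrac_p_neq0 n : (p%:R ^+ n : Qp) != 0.
Proof.
rewrite expf_neq0 // -(rmorph_nat (@FracField.tofrac Zp)) tofrac_eq0.
apply/eqP => /(congr1 (fun x : Zp => x 2)); rewrite residue_nat /=.
rewrite modn_small; first by move=> E; have := prime_gt0 p_prime; rewrite E.
by rewrite -[X in (X < _)%N]expn1 ltn_exp2l // prime_gt1.
Qed.

(** The denominator of x is a power of p times a unit, and the numerator can be
    replaced by a natural number modulo that power. As a consequence Z_p has
    countably many cosets in Q_p. *)
Lemma padic_coset_rep (x : Qp) :
  exists (n a : nat) (z : Zp), x = a%:R / p%:R ^+ n + z%:F.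
Proof.
have [u [v [v0 ->]]] : exists u v : Zp, v != 0 /\ x = u%:F / v%:F.
  elim/quotW: x => r; have d0 : (val r).2 != 0 := denom_ratioP r.
  exists (val r).1, (val r).2; split=> //.
  apply: (canRL (mulfK _)); first by rewrite tofrac_eq0.
  apply: etrans (_ : FracField.mul _ _ = _) _; first by [].
  rewrite !piE; apply/eqmodP; rewrite /= FracField.equivfE /FracField.mulf.
  by rewrite !numden_Ratio ?mulf_neq0 ?oner_eq0 // ?mul1r ?mulr1 mulrC.
have [n [y [z [vE zy]]]] := padic_int_factor v0.
have zyF : z%:F * y%:F = 1 by rewrite -rmorphM zy rmorph1.
have xE : u%:F / v%:F = (u * z)%:F / p%:R ^+ n.
  have y0 : y%:F != 0 by apply: contra_eq_neq zyF => ->; rewrite mulr0 eq_sym oner_neq0.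
  rewrite vE !rmorphM rmorphXn rmorph_nat.
  apply/eqP; rewrite eqr_div ?mulf_neq0 ?tofrac_p_neq0 //; apply/eqP.
  by rewrite mulrACA zyF mulr1.
exists n, ((u * z)%R n).
have [|w wE] := @residue_eq (u * z)%R (((u * z)%R n)%:R)%R n.
  by rewrite residue_nat residue_mod.
exists w; rewrite xE {1}wE rmorphD rmorphM rmorphXn !rmorph_nat mulrDl.
by rewrite [_ * w%:F]mulrC mulfK ?tofrac_p_neq0.
Qed.

Lemma padic_ballP (x y : Qp) : padic_ball x 0 y <-> exists z : Zp, y = x + z%:F.
Proof. by split=> -[z ->]; exists z; rewrite expr0 mul1r. Qed.

Lemma padic_ball_sym x n (y : Qp) : padic_ball x n y -> padic_ball y n x.
Proof. by move=> [z ->]; exists (- z); rewrite rmorphN mulrN addrK. Qed.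

Lemma padic_ball_trans x n (y z : Qp) :
  padic_ball x n y -> padic_ball y n z -> padic_ball x n z.
Proof. by move=> [u ->] [v ->]; exists (u + v); rewrite rmorphD mulrDr addrA. Qed.

Lemma padic_ball_refl x n : @padic_ball p p_prime x n x.
Proof. by exists 0; rewrite rmorph0 mulr0 addr0. Qed.

Lemma padic_ball_eq x n (y : Qp) : padic_ball x n y -> padic_ball x n = padic_ball y n.
Proof.
move=> xy; rewrite eqEsubset; split=> z; last exact: padic_ball_trans.
exact/padic_ball_trans/padic_ball_sym.
Qed.

Lemma padic_ball_open (x : Qp) n : open (padic_ball x n).
Proof.
move=> y xy; exists n => z; exact: padic_ball_trans.
Qed.

Lemma padic_nbhsP (x : Qp) (A : set Qp) :
  nbhs x A <-> exists n, padic_ball x n `<=` A.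
Proof.
split=> [[B [oB Bx BA]]|[n xnA]].
  by have [n xn] := oB _ Bx; exists n; apply: subset_trans BA.
exists (padic_ball x n); split=> //; [exact: padic_ball_open | exact: padic_ball_refl].
Qed.

(** An ultrafilter on x + Z_p selects one residue modulo each p ^ n, and the
    selected residues define its limit. *)
Lemma padic_ball_compact (x : Qp) : compact (padic_ball x 0).
Proof.
rewrite compact_ultra => F UF Fx.
have ex n : exists c, F [set y | exists2 z : Zp, y = x + z%:F & z n = c].
  apply: contrapT => /forallNP no.
  have small k : F [set y | exists2 z : Zp, y = x + z%:F & (k <= z n)%N].
    elim: k => [|k IH]; first by apply: filterS Fx => y /padic_ballP[z ->]; exists z.
    have [/no //|Fn] := in_ultra_setVsetC [set y | exists2 z : Zp, y = x + z%:F & z n = k] UF.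
    apply: filterS (filterI IH Fn) => y [[z yE kz] nz]; exists z => //.
    by rewrite ltn_neqAle kz andbT; apply/eqP => kE; apply: nz; exists z.
  have [y [z _]] := filter_ex (small (p ^ n)%N).
  by rewrite leqNgt residue_lt.
pose c n := projT1 (cid (ex n)).
have Fc n : F [set y | exists2 z : Zp, y = x + z%:F & z n = c n] := projT2 (cid (ex n)).
have coh : padic_coherent p c.
  move=> n; have [y [[z -> zn] [z' /addrI /eqP zz' zn1]]] := filter_ex (filterI (Fc n) (Fc n.+1)).
  by move: zz'; rewrite tofrac_eq => /eqP zz'; rewrite -zn -zn1 -zz' -residue_coherent.
exists (x + (PadicInt p_prime coh)%:F); split.
  by apply/padic_ballP; exists (PadicInt p_prime coh).
move=> A /padic_nbhsP[n nA]; apply: filterS (Fc n) => y [z -> zn]; apply: nA.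
have [w ->] := @residue_eq z (PadicInt p_prime coh) n zn.
by exists w; rewrite rmorphD rmorphM rmorphXn rmorph_nat addrA.
Qed.

(** The balls of radius 1 around the poles are pairwise disjoint: they are where
    permutations of nat are realised. *)
Definition pole k : Qp := p%:R ^- k.+1.

Lemma pole_inj k l : padic_ball (pole k) 0 (pole l) -> k = l.
Proof.
wlog lekl : k l / (k <= l)%N => [H|].
  by case/orP: (leq_total k l) => [/H //|/H + /padic_ball_sym kl] => /(_ kl).
move=> /padic_ballP[z zE].
move: lekl; rewrite leq_eqVlt => /orP[/eqP //|ltkl]; exfalso.
have : p%:R ^+ l.+1 * pole l = p%:R ^+ l.+1 * (pole k + z%:F) by rewrite zE.
rewrite /pole mulfV ?tofrac_p_neq0 //.
have -> : p%:R ^+ l.+1 * (p%:R ^- k.+1 + z%:F) = (p%:R * (p%:R ^+ (l - k).-1 + p%:R ^+ l * z))%:F.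
  rewrite rmorphM rmorphD rmorphM !rmorphXn rmorph_nat !mulrDr.
  congr (_ + _); last by rewrite mulrA -exprS.
  have -> : p%:R ^+ l.+1 = p%:R * p%:R ^+ (l - k).-1 * p%:R ^+ k.+1 :> Qp.
    by rewrite -exprS -exprD; congr (_ ^+ _); lia.
  by rewrite mulfK ?tofrac_p_neq0.
rewrite -(rmorph1 (@FracField.tofrac Zp)) => /eqP; rewrite tofrac_eq => /eqP.
move/(congr1 (fun x : Zp => x 1%N)); rewrite residueM residue_nat expn1 modnn mul0n mod0n.
by rewrite -[X in X = _]/(1 %% p ^ 1)%N expn1 modn_small // prime_gt1.
Qed.

End Padic.

(** * Piecewise translations that permute balls *)

Section Embedding.
Local Open Scope ring_scope.
Variables (p : nat) (p_prime : prime p).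
Local Notation Qp := (padic p_prime).
Variables (G : groupType) (X : Type) (act : G -> X -> X) (code : X -> nat).
Hypothesis act1 : forall x, act 1%g x = x.
Hypothesis actM : forall g h x, act (g * h)%g x = act g (act h x).
Hypothesis act_faithful : forall g, (forall x, act g x = x) -> g = 1%g.
Hypothesis code_inj : injective code.

Local Notation pole_of x := (pole p_prime (code x)).

Definition in_pole_ball (y : Qp) (x : X) : Prop := padic_ball (pole_of x) 0 y.

Lemma in_pole_ball_inj y x x' : in_pole_ball y x -> in_pole_ball y x' -> x = x'.
Proof.
move=> yx yx'; apply/code_inj/(@pole_inj _ p_prime).
exact: padic_ball_trans yx (padic_ball_sym yx').
Qed.

Definition move_poles (g : G) (y : Qp) : Qp :=
  if pselect (exists x, in_pole_ball y x) is left ex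
  then y - pole_of (projT1 (cid ex)) + pole_of (act g (projT1 (cid ex))) else y.

Lemma move_polesE g y x : in_pole_ball y x ->
  move_poles g y = y - pole_of x + pole_of (act g x).
Proof.
move=> yx; rewrite /move_poles; case: pselect => [ex|[]]; last by exists x.
by rewrite (in_pole_ball_inj (projT2 (cid ex)) yx).
Qed.

Lemma move_poles_out g y : ~ (exists x, in_pole_ball y x) -> move_poles g y = y.
Proof. by move=> nx; rewrite /move_poles; case: pselect. Qed.

Lemma in_move_poles g y x : in_pole_ball y x -> in_pole_ball (move_poles g y) (act g x).
Proof.
move=> yx; rewrite (move_polesE g yx); case: yx => z ->.
by exists z; rewrite [_ + _ - _]addrAC subrr add0r addrC.
Qed.

Lemma move_poles1 y : move_poles 1%g y = y.
Proof.
have [[x yx]|nx] := pselect (exists x, in_pole_ball y x); last exact: move_poles_out.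
by rewrite (move_polesE _ yx) act1 subrK.
Qed.

Lemma move_polesM g h y : move_poles (g * h)%g y = move_poles g (move_poles h y).
Proof.
have [[x yx]|nx] := pselect (exists x, in_pole_ball y x); last by rewrite !move_poles_out.
by rewrite (move_polesE _ (in_move_poles h yx)) !(move_polesE _ yx) actM addrK.
Qed.

(** This is what makes the map both continuous and piecewise affine. *)
Lemma move_poles_local g y : exists b, forall z, padic_ball y 0 z -> move_poles g z = z + b.
Proof.
have [[x yx]|nx] := pselect (exists x, in_pole_ball y x).
  exists (- pole_of x + pole_of (act g x)) => z yz.
  by rewrite (move_polesE g (padic_ball_trans yx yz)) addrA.
exists 0 => z yz; rewrite addr0 move_poles_out // => -[x zx]; apply: nx; exists x.
exact: padic_ball_trans zx (padic_ball_sym yz).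
Qed.

Lemma move_poles_continuous g : continuous (move_poles g).
Proof.
move=> y A /padic_nbhsP[n nA]; apply/padic_nbhsP; exists n => z yz; apply: nA.
have [b bE] := move_poles_local g y.
rewrite !bE; [|exact: padic_ball_le yz|exact: padic_ball_refl].
by case: yz => w ->; exists w; rewrite addrAC.
Qed.

Lemma move_poles_homeo g : is_homeo (move_poles g).
Proof.
split; first exact: move_poles_continuous.
exists (move_poles g^-1%g); split; last exact: move_poles_continuous.
  by move=> y; rewrite -move_polesM mulVg move_poles1.
by move=> y; rewrite -move_polesM mulgV move_poles1.
Qed.

Definition pole_homeo g : homeo Qp := Homeo (move_poles_homeo g).

Lemma pole_homeoM : {morph pole_homeo : g h / (g * h)%g}.
Proof. by move=> g h; apply: homeo_inj => y /=; rewrite move_polesM. Qed.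

HB.instance Definition _ := isMultiplicative.Build G (homeo Qp) pole_homeo pole_homeoM.

Lemma pole_homeo_inj : injective pole_homeo.
Proof.
suff H g : pole_homeo g = pole_homeo 1%g -> g = 1%g.
  move=> g h gh; apply: (@mulIg _ h^-1%g); rewrite mulgV; apply: H.
  by rewrite pole_homeoM gh -pole_homeoM mulgV.
move=> /(congr1 (@homeo_fun _)) /= E; apply: act_faithful => x.
have xx : in_pole_ball (pole_of x) x by exact: padic_ball_refl.
apply: (in_pole_ball_inj (in_move_poles g xx)).
by rewrite E move_poles1.
Qed.

(** The partition consists of the cosets of Z_p, each of them being indexed by
    the first of its names (n, a), which stand for a / p ^ n. *)
Lemma pole_homeo_PL g : PL (pole_homeo g).
Proof.
pose rep k : Qp := if choice.unpickle k is Some (n, a) then (a : nat)%:R / p%:R ^+ (n : nat) else 0.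
pose U k := padic_ball (rep k) 0.
exists [set k | forall j, (j < k)%N -> U j <> U k], U; split; last first.
  move=> k _; split; [exact: padic_ball_compact | exact: padic_ball_open|].
  have [b bE] := move_poles_local g (rep k).
  by exists 1, b; split=> [|y /bE]; rewrite ?oner_neq0 ?mul1r.
split.
- rewrite eqEsubset; split=> // y _.
  have [n [a [z yE]]] := padic_coset_rep y.
  have ex : exists k, `[< U k y >].
    exists (choice.pickle (n, a)); apply/asboolP; rewrite /U /rep choice.pickleK.
    by apply/padic_ballP; exists z.
  have [k /asboolP Uk mink] := ex_minnP ex; exists k => //= j ltjk UjUk.
  by move: ltjk; rewrite ltnNge mink //; apply/asboolP; rewrite UjUk.
- move=> i j /= iD jD [y [Ui Uj]].
  have UU : U i = U j by rewrite /U (padic_ball_eq Ui) (padic_ball_eq Uj).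
  by case: (ltngtP i j) => // [/jD|/iD]; rewrite UU.
- by move=> k _; exists (rep k); exact: padic_ball_refl.
Qed.

Lemma PL_embedding : exists f : {multiplicative G -> homeo Qp},
  injective f /\ (forall g, PL (f g)).
Proof.
exists pole_homeo; split; [exact: pole_homeo_inj | exact: pole_homeo_PL].
Qed.

End Embedding.

(** * The direct limit of the groups V_n x W_n *)

Section Tower.
Local Notation repr := generic_quotient.repr.
Variable K : nat -> finGroupType.

(** These are the groups V_n. *)
Fixpoint tower (n : nat) : finGroupType :=
  if n is n'.+1 then stage (tower n' * K n')%type n' else {perm void}.

Definition climb n (v : tower n) (k : K n) : tower n.+1 :=
  @stage_emb (tower n * K n)%type n (v, k).

Lemma climbM n (v v' : tower n) (k k' : K n) :
  climb (v * v')%g (k * k')%g = (climb v k * climb v' k')%g.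
Proof. exact: (@stage_embM (tower n * K n)%type n (v, k) (v', k')). Qed.

Lemma climb_inj n (v v' : tower n) (k k' : K n) :
  climb v k = climb v' k' -> v = v' /\ k = k'.
Proof. by move/(@stage_emb_inj (tower n * K n)%type n) => [-> ->]. Qed.

Lemma climb1 n : climb 1%g 1%g = 1%g :> tower n.+1.
Proof. by apply: (@mulgI _ (climb 1%g 1%g)); rewrite mulg1 -climbM !mulg1. Qed.

Lemma climbV n (v : tower n) (k : K n) : (climb v k)^-1%g = climb v^-1%g k^-1%g.
Proof. by apply: (@mulgI _ (climb v k)); rewrite mulgV -climbM !mulgV climb1. Qed.

(** An element of V_n x W_n is recorded by its images in V_m for m >= n: the step
    from V_m to V_(m+1) reveals its component in K_m. Elements of the direct
    limit are germs at infinity of such sequences. *)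
Record thread : Type := Thread {
  thread_at :> forall n, tower n;
  thread_climb : exists n, forall m, (n <= m)%N ->
    exists k, thread_at m.+1 = climb (thread_at m) k }.

HB.instance Definition _ := gen_eqMixin thread.
HB.instance Definition _ := gen_choiceMixin thread.

Definition ev_eq (x y : forall n, tower n) : Prop :=
  exists n, forall m, (n <= m)%N -> x m = y m.

Lemma ev_eq_refl (x : forall n, tower n) : ev_eq x x.
Proof. by exists 0. Qed.

Lemma ev_eq_sym (x y : forall n, tower n) : ev_eq x y -> ev_eq y x.
Proof. by move=> [n xy]; exists n => m /xy. Qed.

Lemma ev_eq_trans (x y z : forall n, tower n) : ev_eq x y -> ev_eq y z -> ev_eq x z.
Proof.
move=> [n xy] [n' yz]; exists (maxn n n') => m.
by rewrite geq_max => /andP[/xy -> /yz].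
Qed.

Lemma ev_eqM (x y x' y' : forall n, tower n) : ev_eq x x' -> ev_eq y y' ->
  ev_eq (fun n => x n * y n)%g (fun n => x' n * y' n)%g.
Proof.
move=> [n xx] [n' yy]; exists (maxn n n') => m.
by rewrite geq_max => /andP[/xx -> /yy ->].
Qed.

Lemma ev_eqV (x x' : forall n, tower n) : ev_eq x x' ->
  ev_eq (fun n => (x n)^-1)%g (fun n => (x' n)^-1)%g.
Proof. by move=> [n xx]; exists n => m /xx ->. Qed.

Definition thread_eq : rel thread := fun x y => `[< ev_eq x y >].

Lemma thread_eq_refl : reflexive thread_eq.
Proof. by move=> x; apply/asboolP/ev_eq_refl. Qed.
Lemma thread_eq_sym : symmetric thread_eq.
Proof. by move=> x y; apply/asboolP/asboolP; apply: ev_eq_sym. Qed.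
Lemma thread_eq_trans : transitive thread_eq.
Proof. by move=> y x z /asboolP xy /asboolP yz; apply/asboolP/(ev_eq_trans xy). Qed.

Canonical thread_equiv :=
  EquivRel thread_eq thread_eq_refl thread_eq_sym thread_eq_trans.

Definition limit := {eq_quot thread_equiv}.
HB.instance Definition _ := Choice.on limit.

Definition germ (x : thread) : limit := \pi_limit x.

Lemma germ_eq (x y : thread) : ev_eq x y -> germ x = germ y.
Proof. by move=> xy; apply/eqmodP/asboolP. Qed.

Lemma repr_germ (x : thread) : ev_eq (repr (germ x)) x.
Proof.
have : germ (repr (germ x)) = germ x by rewrite /germ reprK.
by move/eqmodP/asboolP.
Qed.

Lemma germ_repr (g : limit) : germ (repr g) = g.
Proof. exact: reprK. Qed.

Lemma thread_oneP : exists n, forall m, (n <= m)%N -> exists k : K m,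
  (1 : tower m.+1)%g = climb 1%g k.
Proof.
by exists 0 => m _; exists 1%g; rewrite climb1.
Qed.
Definition thread_one : thread := Thread thread_oneP.

Lemma thread_mulP (x y : thread) : exists n, forall m, (n <= m)%N -> exists k : K m,
  (x m.+1 * y m.+1)%g = climb (x m * y m)%g k.
Proof.
have [n xP] := thread_climb x; have [n' yP] := thread_climb y.
exists (maxn n n') => m; rewrite geq_max => /andP[/xP[k ->] /yP[k' ->]].
by exists (k * k')%g; rewrite climbM.
Qed.
Definition thread_mul (x y : thread) : thread := Thread (thread_mulP x y).

Lemma thread_invP (x : thread) : exists n, forall m, (n <= m)%N -> exists k : K m,
  ((x m.+1)^-1)%g = climb ((x m)^-1)%g k.
Proof.
have [n xP] := thread_climb x.
by exists n => m /xP[k ->]; exists (k^-1)%g; rewrite climbV.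
Qed.
Definition thread_inv (x : thread) : thread := Thread (thread_invP x).

Definition limit_one : limit := germ thread_one.
Definition limit_mul (g h : limit) : limit := germ (thread_mul (repr g) (repr h)).
Definition limit_inv (g : limit) : limit := germ (thread_inv (repr g)).

Lemma germM x y : limit_mul (germ x) (germ y) = germ (thread_mul x y).
Proof. by apply: germ_eq; apply: ev_eqM; apply: repr_germ. Qed.

Lemma germV x : limit_inv (germ x) = germ (thread_inv x).
Proof. by apply: germ_eq; apply: ev_eqV; apply: repr_germ. Qed.

Lemma limit_mulA : associative limit_mul.
Proof.
move=> f g h; rewrite -(germ_repr f) -(germ_repr g) -(germ_repr h) !germM.
by apply: germ_eq; exists 0 => m _ /=; rewrite mulgA.
Qed.
Lemma limit_mul1g : left_id limit_one limit_mul.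
Proof.
move=> g; rewrite -(germ_repr g) germM.
by apply: germ_eq; exists 0 => m _ /=; rewrite mul1g.
Qed.
Lemma limit_mulg1 : right_id limit_one limit_mul.
Proof.
move=> g; rewrite -(germ_repr g) germM.
by apply: germ_eq; exists 0 => m _ /=; rewrite mulg1.
Qed.
Lemma limit_mulVg : left_inverse limit_one limit_inv limit_mul.
Proof.
move=> g; rewrite -(germ_repr g) germV germM.
by apply: germ_eq; exists 0 => m _ /=; rewrite mulVg.
Qed.
Lemma limit_mulgV : right_inverse limit_one limit_inv limit_mul.
Proof.
move=> g; rewrite -(germ_repr g) germV germM.
by apply: germ_eq; exists 0 => m _ /=; rewrite mulgV.
Qed.

HB.instance Definition _ := isGroup.Build limit limit_mulA limit_mul1g
  limit_mulg1 limit_mulVg limit_mulgV.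

Local Notation P := (prod_group K).

(** The sequence in which only the value v at n is prescribed provides the
    initial value at index n without a transport along an equality of indices. *)
Fixpoint run n (v : tower n) (w : P) m : tower m :=
  if m is m'.+1 then
    if (m'.+1 <= n)%N then dfwith (fun m => 1%g : tower m) n v m'.+1
    else climb (run v w m') (w m')
  else dfwith (fun m => 1%g : tower m) n v 0.

Lemma run_start n (v : tower n) w : run v w n = v.
Proof. by case: n v => [|n] v /=; rewrite ?leqnn dfwithin. Qed.

Lemma run_climb n (v : tower n) w m : (n <= m)%N -> run v w m.+1 = climb (run v w m) (w m).
Proof. by move=> nm /=; rewrite leqNgt ltnS nm. Qed.

Lemma runP n (v : tower n) w : exists j, forall m, (j <= m)%N ->
  exists k, run v w m.+1 = climb (run v w m) k.
Proof. by exists n => m nm; exists (w m); exact: run_climb. Qed.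

(** The inclusion of V_n x W_n, where W_n consists of the components of w of
    index at least n. *)
Definition emb n (v : tower n) (w : P) : limit := germ (Thread (runP v w)).

Lemma embM n (v v' : tower n) (w w' : P) :
  emb (v * v')%g (w * w')%g = (emb v w * emb v' w')%g.
Proof.
apply/esym/(etrans (germM _ _))/germ_eq; exists n => m nm /=.
rewrite -(subnK nm); elim: (m - n)%N => [|k IH].
  by rewrite add0n !run_start.
by rewrite addSn !run_climb ?leq_addl // -climbM IH.
Qed.

Lemma emb1 n : emb (1 : tower n)%g 1%g = 1%g.
Proof. by apply: (@mulgI _ (emb (1 : tower n)%g 1%g)); rewrite -embM !mulg1. Qed.

Lemma embV n (v : tower n) (w : P) : (emb v w)^-1%g = emb v^-1%g w^-1%g.
Proof. by apply: (@mulgI _ (emb v w)); rewrite mulgV -embM !mulgV emb1. Qed.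

Lemma emb_ext n (v : tower n) (w w' : P) :
  (forall m, (n <= m)%N -> w m = w' m) -> emb v w = emb v w'.
Proof.
move=> ww; apply: germ_eq; exists n => m nm /=.
rewrite -(subnK nm); elim: (m - n)%N => [|k IH]; first by rewrite add0n !run_start.
by rewrite addSn !run_climb ?leq_addl // IH ww // leq_addl.
Qed.

(** Threads that agree far out agree down to n, as climb is injective. *)
Lemma emb_inj n (v v' : tower n) (w w' : P) : emb v w = emb v' w' ->
  v = v' /\ forall m, (n <= m)%N -> w m = w' m.
Proof.
move=> /eqmodP/asboolP[j E].
have down m : (n <= m)%N -> run v w m.+1 = run v' w' m.+1 ->
    run v w m = run v' w' m /\ w m = w' m.
  by move=> nm; rewrite !run_climb // => /climb_inj.
have all m : (n <= m)%N -> run v w m = run v' w' m.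
  move=> nm; have : run v w (j + m)%N = run v' w' (j + m)%N by apply: E; rewrite leq_addr.
  elim: (j) => // i IH; rewrite addSn => /down H; apply: IH.
  by have [] := H (leq_trans nm (leq_addl _ _)).
split; first by have := all n (leqnn n); rewrite !run_start.
by move=> m nm; have [] := down m nm (all _ (leqW nm)).
Qed.

Lemma emb_surj (g : limit) : exists n (v : tower n) (w : P), g = emb v w.
Proof.
have [n gP] := thread_climb (repr g).
pose w m : K m := if pselect (exists k, repr g m.+1 = climb (repr g m) k) is left ex
  then projT1 (cid ex) else 1%g.
exists n, (repr g n), w; rewrite -[LHS]germ_repr; apply: germ_eq; exists n => m nm /=.
rewrite -(subnK nm); elim: (m - n)%N => [|k IH]; first by rewrite add0n run_start.
rewrite addSn run_climb ?leq_addl // -IH /w; case: pselect => [ex|[]].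
  exact: projT2 (cid ex).
by apply: gP; rewrite leq_addl.
Qed.

Lemma emb_climb n (v : tower n) (w : P) : emb v w = emb (climb v (w n)) w.
Proof.
apply: germ_eq; exists n.+1 => m nm /=.
rewrite -(subnK nm); elim: (m - n.+1)%N => [|k IH].
  by rewrite add0n run_start run_climb // run_start.
by rewrite addSn !run_climb ?leq_addl // ?(leq_trans _ (leq_addl _ _)) // IH.
Qed.

Lemma emb_up n m (v : tower n) (w : P) : (n <= m)%N -> exists v' : tower m, emb v w = emb v' w.
Proof.
move=> /subnK <-; elim: (m - n)%N => [|k [v' ->]]; first by exists v.
by exists (climb v' (w (k + n)%N)); exact: emb_climb.
Qed.

End Tower.

(** * The topology of the direct limit *)

Section LimitTopology.
Variable K : nat -> finGroupType.
Local Notation P := (prod_group K).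
Local Notation G := (limit K).
Local Open Scope group_scope.

(** The cosets of W_n in V_n x W_n: a countable basis of compact open sets. *)
Definition cylinder n (v : tower K n) : set G := range (emb v).

(** The inclusion of W_n. *)
Definition tail n (w : P) : G := emb (1 : tower K n) w.

Lemma tailM n w w' : tail n (w * w') = tail n w * tail n w'.
Proof. by rewrite /tail -embM mulg1. Qed.
Lemma tailV n w : (tail n w)^-1 = tail n w^-1.
Proof. by rewrite /tail embV invg1. Qed.
Lemma tail1 n : tail n 1 = 1.
Proof. exact: emb1. Qed.

Lemma emb_tail n (v : tower K n) w w' : emb v w * tail n w' = emb v (w * w').
Proof. by rewrite /tail -embM mulg1. Qed.

Lemma tail_emb n (v : tower K n) w w' : tail n w' * emb v w = emb v (w' * w).
Proof. by rewrite /tail -embM mul1g. Qed.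

Lemma tailS n w : tail n.+1 w = tail n (dfwith w n (1 : K n)).
Proof.
rewrite /tail [RHS]emb_climb dfwithin climb1; apply: emb_ext => m nm.
by rewrite dfwithout // neq_ltn nm.
Qed.

Lemma tail_le n m w : (n <= m)%N -> exists w', tail m w = tail n w'.
Proof.
move=> /subnK <-; elim: (m - n)%N w => [|k IH] w; first by exists w.
by rewrite addSn tailS; exact: IH.
Qed.

Lemma tail_shift n m (w : P) : (n <= m)%N ->
  (forall i, (i < m)%N -> w i = 1%g) -> tail n w = tail m w.
Proof.
move=> /subnK <-; elim: (m - n)%N => [//|k IH] w1.
rewrite addSn tailS IH; last by move=> i ik; apply: w1; rewrite addSn ltnW.
apply: emb_ext => i _; have [E|ne] := eqVneq (k + n)%N i; last by rewrite dfwithout.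
by subst i; rewrite dfwithin w1 ?addSn.
Qed.

Lemma emb_surj_ge (g : G) n : exists m (v : tower K m) w, (n <= m)%N /\ g = emb v w.
Proof.
have [j [v [w ->]]] := emb_surj g; have [v' E] := emb_up v w (leq_maxl j n).
by exists (maxn j n), v', w; rewrite leq_maxr.
Qed.

(** An element of all the W_n has a trivial image in every V_m, hence trivial
    components. *)
Lemma tail_cap (g : G) : (forall n, exists w, g = tail n w) -> g = 1.
Proof.
move=> gT; have [n [v [w gE]]] := emb_surj g.
have runE m : (n <= m)%N -> g = emb (run v w m) w.
  move=> /subnK <-; elim: (m - n)%N => [|k IH]; first by rewrite add0n run_start.
  by rewrite addSn run_climb ?leq_addl // -emb_climb.
have run1 m : (n <= m)%N -> run v w m = 1.
  by move=> nm; have [w'] := gT m; rewrite (runE m nm) => /emb_inj[].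
have v1 := run1 n (leqnn n); rewrite run_start in v1.
rewrite gE v1 -(emb1 K n); apply: emb_ext => m nm.
have := run1 m.+1 (leqW nm); rewrite run_climb // run1 // -(climb1 K m).
by move=> /climb_inj[].
Qed.

Definition tail_coset (x : G) n : set G := [set x * tail n w | w in setT].

(** A given element of G normalises W_n for all large n, so that left and right
    cosets of the subgroups W_n generate the same topology. *)
Definition limit_open : set_system G :=
  [set U | forall g, U g -> exists n, forall w, U (g * tail n w)].

Lemma limit_openT : limit_open setT.
Proof. by move=> g _; exists 0. Qed.

Lemma limit_openI : setI_closed limit_open.
Proof.
move=> A B oA oB g [/oA[n An] /oB[m Bm]]; exists (maxn n m) => w; split.
  by have [w' ->] := tail_le w (leq_maxl n m).
by have [w' ->] := tail_le w (leq_maxr n m).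
Qed.

Lemma limit_open_bigU (I : Type) (f : I -> set G) :
  (forall i, limit_open (f i)) -> limit_open (\bigcup_i f i).
Proof. by move=> of_ g [i _ /of_[n fin]]; exists n => w; exists i. Qed.

HB.instance Definition _ := isOpenTopological.Build G
  limit_openT limit_openI limit_open_bigU.

Lemma limit_nbhsP (g : G) (A : set G) :
  nbhs g A <-> exists n, forall w, A (g * tail n w).
Proof.
split=> [[B [oB Bg BA]]|[n nA]].
  by have [n nB] := oB _ Bg; exists n => w; apply/BA/nB.
exists (tail_coset g n); split.
- move=> _ [w _ <-]; exists n => w'; exists (w * w') => //.
  by rewrite tailM mulgA.
- by exists 1 => //; rewrite tail1 mulg1.
- by move=> _ [w _ <-].
Qed.

(** Every element lies in V_m x W_m for all large m, and then it normalises W_m. *)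
Lemma limit_mulg_continuous : continuous (fun x : G * G => (x.1 * x.2)%g).
Proof.
move=> [g h] A /limit_nbhsP[n nA] /=.
have [m [v [u [nm hE]]]] := emb_surj_ge h n.
exists (tail_coset g m, tail_coset h m).
  by split; apply/limit_nbhsP; exists m => w; exists w.
move=> [_ _] [/= [w _ <-] [w' _ <-]].
have -> : g * tail m w * (h * tail m w') = g * h * tail m (u^-1 * w * u * w').
  rewrite -!mulgA; congr (_ * _); rewrite hE emb_tail tail_emb emb_tail.
  by rewrite !mulgA mulgV mul1g.
by have [w'' ->] := tail_le (u^-1 * w * u * w') nm; exact: nA.
Qed.

Lemma limit_invg_continuous : continuous (fun x : G => (x^-1)%g).
Proof.
move=> g A /limit_nbhsP[n nA].
have [m [v [u [nm gE]]]] := emb_surj_ge g n.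
apply/limit_nbhsP; exists m => w; rewrite /preimage /=.
have -> : (g * tail m w)^-1 = g^-1 * tail m (u * w^-1 * u^-1).
  by rewrite gE embV !emb_tail embV !invMg !mulgA mulVg mul1g.
by have [w' ->] := tail_le (u * w^-1 * u^-1) nm; exact: nA.
Qed.

HB.instance Definition _ := isTopologicalGroup.Build G
  limit_mulg_continuous limit_invg_continuous.

Lemma cylinder_open n (v : tower K n) : open (cylinder v).
Proof.
by move=> _ [w _ <-]; exists n => w'; rewrite emb_tail; exists (w * w').
Qed.

Lemma emb_continuous n (v : tower K n) : continuous (emb v : P -> G).
Proof.
move=> w A /limit_nbhsP[m mA].
have FF : Filter (nbhs w) := nbhs_filter w.
have near k : nbhs w (fun w' : P => forall i, (i < k)%N -> w' i = w i).
  elim: k => [|k IH].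
    by apply: (@filterS _ _ FF) (prod_coord_near w 0) => w' _ i; rewrite ltn0.
  apply: (@filterS _ _ FF) (@filterI _ _ FF _ _ IH (prod_coord_near w k)) => w' [wk wkk] i.
    by rewrite ltnS leq_eqVlt => /orP[/eqP ->|/wk].
apply: (@filterS _ _ FF) (near (maxn m n)) => w' ww' /=.
have -> : emb v w' = emb v w * tail (maxn m n) (w^-1 * w').
  suff <- : tail n (w^-1 * w') = tail (maxn m n) (w^-1 * w').
    by rewrite emb_tail mulgA mulgV mul1g.
  apply: tail_shift (leq_maxr m n) _ => i lti.
  by apply: (etrans (_ : _ = (w i)^-1 * (w' i))) => //; rewrite ww' // mulVg.
by have [w'' ->] := tail_le (w^-1 * w') (leq_maxl m n); exact: mA.
Qed.

Lemma prod_group_compact : compact [set: P].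
Proof.
have H := @tychonoff nat (fun i => discrete_topology (K i)) (fun=> setT).
have E : [set f : forall i, discrete_topology (K i) | forall i, setT (f i)] = setT.
  by rewrite eqEsubset; split.
rewrite E in H; apply: H => i; apply: finite_compact; exact: (@finite_finset (K i)).
Qed.

Lemma cylinder_compact n (v : tower K n) : compact (cylinder v).
Proof.
apply: continuous_compact prod_group_compact.
by apply: continuous_subspaceT; exact: emb_continuous.
Qed.

Lemma limit_separated (x y : G) : x != y ->
  exists n, ~ exists w, y = x * tail n w.
Proof.
move=> xy; apply: contrapT => /forallNP H.
have /tail_cap E : forall n, exists w, x^-1 * y = tail n w.
  by move=> n; have /contrapT[w ->] := H n; exists w; rewrite mulgA mulVg mul1g.
by move/eqP: xy; apply; apply: (@mulgI _ x^-1); rewrite E mulVg.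
Qed.

Lemma tail_coset_open (x : G) n : open (tail_coset x n).
Proof.
by move=> _ [w _ <-]; exists n => w'; exists (w * w') => //; rewrite tailM mulgA.
Qed.

Lemma tail_coset_closed (x : G) n : closed (tail_coset x n).
Proof.
rewrite -[X in closed X]setCK; apply: open_closedC.
rewrite -[open _]/(limit_open _) => y /= yx; exists n => w [w' _ E]; apply: yx.
by exists (w' * w^-1) => //; rewrite tailM -tailV mulgA E -mulgA mulgV mulg1.
Qed.

Lemma limit_zero_dimensional : zero_dimensional G.
Proof.
move=> x y /limit_separated[n xy]; exists (tail_coset x n); split.
- by split; [exact: tail_coset_open | exact: tail_coset_closed].
- by exists 1 => //; rewrite tail1 mulg1.
- by move=> [w _ E]; apply: xy; exists w.
Qed.

Lemma limit_hausdorff : hausdorff_space G.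
Proof.
rewrite open_hausdorff => x y /limit_zero_dimensional[U [[oU cU] Ux Uy]].
exists (U, ~` U); first by split; apply/mem_set.
by split=> //=; [exact: closed_openC | rewrite setICr].
Qed.

Lemma cylinder_closed n (v : tower K n) : closed (cylinder v).
Proof. exact: compact_closed limit_hausdorff (@cylinder_compact n v). Qed.

Lemma cylinder_nbhs (g : G) (A : set G) : nbhs g A ->
  exists n (v : tower K n), cylinder v g /\ cylinder v `<=` A.
Proof.
move=> /limit_nbhsP[n nA]; have [m [v [u [nm gE]]]] := emb_surj_ge g n.
exists m, v; split; first by rewrite gE; exists u.
move=> _ [w _ <-]; have -> : emb v w = g * tail m (u^-1 * w).
  by rewrite gE emb_tail mulgA mulgV mul1g.
by have [w' ->] := tail_le (u^-1 * w) nm; exact: nA.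
Qed.

Lemma limit_locally_compact : locally_compact [set: G].
Proof.
move=> g _; have [n [v [gv _]]] := cylinder_nbhs (@filterT _ _ (nbhs_filter g)).
exists (cylinder v).
  have := @open_nbhs_nbhs _ g (cylinder v) (conj (@cylinder_open n v) gv).
  by apply: filterS => x.
by split; [exact: cylinder_compact | exact: cylinder_closed].
Qed.

Lemma limit_second_countable : @second_countable G.
Proof.
exists [set cylinder (projT2 c) | c in [set: {n & tower K n}]].
  exact: sub_countable (card_image_le _ _) (countableP _).
split=> [_ [c _ <-]|g A /cylinder_nbhs[n [v [gv vA]]]]; first exact: cylinder_open.
exists (cylinder v) => //; split=> //.
by exists (existT _ n v).
Qed.

HB.instance Definition _ := isLCSCGroup.Build G
  limit_hausdorff limit_locally_compact limit_second_countable.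

Lemma limit_totally_disconnected : totally_disconnected [set: G].
Proof. exact: zero_dimension_totally_disconnected limit_zero_dimensional. Qed.

(** The subgroup W_0 is open and closed, so that the coordinates on W_0 can be
    extended to G by a constant. *)
Lemma tail0_inverse : exists2 f : G -> P, continuous f & cancel (tail 0) f.
Proof.
pose f (g : G) : P := if pselect (exists w, g = tail 0 w) is left ex
  then projT1 (cid ex) else 1.
have fK w : f (tail 0 w) = w.
  rewrite /f; case: pselect => [ex|[]]; last by exists w.
  have /esym/emb_inj[_ E] := projT2 (cid ex).
  by apply: functional_extensionality_dep => i; exact: E.
exists f => //; apply: continuous_prod_group => x i.
have [[w xE]|nx] := pselect (exists w, x = tail 0 w); last first.
  apply/limit_nbhsP; exists 0 => w /=; rewrite /f.
  case: pselect => [[w' E]|_]; last by case: pselect.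
  by case: nx; exists (w' * w^-1); rewrite tailM -E -tailV -mulgA mulgV mulg1.
apply/limit_nbhsP; exists i.+1 => u /=.
pose u' : P := fun j => if (j < i.+1)%N then 1%g else u j.
have -> : tail i.+1 u = tail 0 u'.
  rewrite (@tail_shift 0 i.+1) // => [|j lj]; last by rewrite /u' lj.
  by apply: emb_ext => j ij; rewrite /u' ltnNge ij.
rewrite xE -tailM !fK; apply: (etrans (_ : _ = (w i : K i) * u' i)) => //.
by rewrite /u' ltnSn mulg1.
Qed.

(** The open subgroup W_0 is isomorphic to the whole product. *)
Lemma limit_locally_isomorphic (Q : topGroupType) (phi : P -> Q) (psi : Q -> P) :
  continuous phi -> continuous psi -> cancel phi psi -> cancel psi phi ->
  {morph phi : x y / x * y} -> locally_isomorphic G Q.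
Proof.
move=> cphi cpsi phiK psiK phiM; have [f cf fK] := tail0_inverse.
exists (range (tail 0)), setT; split.
- exact: cylinder_open.
- apply/group_closed_setP; split; first by exists 1 => //; exact: tail1.
  by move=> _ _ [w _ <-] [w' _ <-]; exists (w * w'^-1); rewrite // tailM tailV.
- exact: openT.
- exact/group_closed_setP.
exists (phi \o f), (tail 0 \o psi); split.
- by split=> [//|x _]; exists (psi x).
- by split=> [g /set_mem[w _ <-]|x _] /=; rewrite fK ?phiK ?psiK.
- by move=> g h /set_mem[w _ <-] /set_mem[w' _ <-] /=; rewrite -tailM !fK phiM.
- by apply: continuous_subspaceT => x; apply: continuous_comp; [exact: cf | exact: cphi].
- apply: continuous_subspaceT => x; apply: continuous_comp; first exact: cpsi.
  exact: emb_continuous.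
Qed.

(** The cosets of all the W_n. The action on them is faithful since the
    intersection of the W_n is trivial. *)
Definition coset_space := {A : set G | exists n x, A = tail_coset x n}.

Lemma coset_actP (g : G) (A : coset_space) :
  exists n x, [set g * y | y in sval A] = tail_coset x n.
Proof.
case: A => _ /= [n [x ->]]; exists n, (g * x); rewrite eqEsubset; split.
  by move=> _ [_ [w _ <-] <-]; exists w; rewrite // mulgA.
by move=> _ [w _ <-]; exists (x * tail n w); rewrite ?mulgA //; exists w.
Qed.

Definition coset_act (g : G) (A : coset_space) : coset_space := exist _ _ (coset_actP g A).

Lemma coset_space_inj (A B : coset_space) : sval A = sval B -> A = B.
Proof.
case: A B => [A pA] [B pB] /= AB; subst B.
by rewrite (Prop_irrelevance pA pB).
Qed.

Lemma coset_act1 A : coset_act 1 A = A.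
Proof.
apply: coset_space_inj; rewrite /= eqEsubset; split=> [_ [y Ay <-]|y Ay].
  by rewrite mul1g.
by exists y; rewrite ?mul1g.
Qed.

Lemma coset_actM g h A : coset_act (g * h) A = coset_act g (coset_act h A).
Proof.
apply: coset_space_inj; rewrite /= eqEsubset; split=> [_ [y Ay <-]|_ [_ [y Ay <-] <-]].
  by exists (h * y); rewrite ?mulgA //; exists y.
by exists y; rewrite ?mulgA.
Qed.

Lemma coset_act_faithful g : (forall A, coset_act g A = A) -> g = 1.
Proof.
move=> gA; apply: tail_cap => n.
have ex : exists m x, tail_coset 1 n = tail_coset x m by exists n, 1.
have /(congr1 sval) /= E := gA (exist _ _ ex).
have : tail_coset 1 n g.
  by rewrite -E; exists 1; rewrite ?mulg1 //; exists 1; rewrite // tail1 mulg1.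
by move=> [w _ <-]; exists w; rewrite mul1g.
Qed.

(** Every coset of W_n meets the countable union of the finite groups V_m. *)
Lemma coset_space_code (A : coset_space) :
  exists c : nat * {n & tower K n}, sval A = tail_coset (emb (projT2 c.2) 1) c.1.
Proof.
case: A => _ /= [n [x ->]]; have [m [v [u [nm xE]]]] := emb_surj_ge x n.
exists (n, existT _ m v) => /=; have [w wE] := tail_le u nm.
have {}xE : x = emb v 1 * tail n w by rewrite -wE emb_tail mul1g.
rewrite eqEsubset; split=> _ [w' _ <-]; rewrite xE.
  by exists (w * w') => //; rewrite tailM mulgA.
by exists (w^-1 * w') => //; rewrite tailM -tailV -!mulgA mulKVg.
Qed.

Definition coset_code (A : coset_space) : nat := choice.pickle (projT1 (cid (coset_space_code A))).

Lemma coset_code_inj : injective coset_code.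
Proof.
move=> A B /(pcan_inj choice.pickleK) E; apply: coset_space_inj.
by rewrite (projT2 (cid (coset_space_code A))) E -(projT2 (cid (coset_space_code B))).
Qed.

Lemma limit_PL p (p_prime : prime p) : exists f : {multiplicative G -> homeo (padic p_prime)},
  injective f /\ (forall g, PL (f g)).
Proof.
exact: (@PL_embedding _ _ G coset_space coset_act coset_code coset_act1 coset_actM
  coset_act_faithful coset_code_inj).
Qed.

End LimitTopology.

(** * The space of closed subgroups *)

Section ChabautyGeneric.
Variable G : topGroupType.
Local Notation Sub := (closed_subgroup G).

Lemma chabauty_subbase_open (W : set Sub) : chabauty_subbase W -> open W.
Proof.
move=> sW; exists [set W]; last by rewrite bigcup_set1.
move=> _ ->; exists [fset W]%fset; last by rewrite set_fset1 bigcap_set1.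
by move=> _ /fset1P ->; apply/mem_set.
Qed.

Lemma open_subbase (U : set Sub) (H : Sub) : open U -> U H ->
  exists D : {fset set Sub}, [/\ forall W, W \in D -> chabauty_subbase W,
    forall W, W \in D -> W H & forall H' : Sub, (forall W, W \in D -> W H') -> U H'].
Proof.
move=> [D' sD' <-] [W0 D'W0 W0H]; have [D sD WE] := sD' _ D'W0.
exists D; split=> [W /sD /set_mem //|W WD|H' HW].
  by have W0H' : W0 H := W0H; move: W0H'; rewrite -WE => /(_ W WD).
have W0H' : W0 H' by rewrite -WE => W WD; exact: HW WD.
by exists W0.
Qed.

Lemma meets_open (V : set G) : open V -> compact (closure V) ->
  open [set H : Sub | (H : set G) `&` V !=set0].
Proof. by move=> oV cV; apply: chabauty_subbase_open; left; exists V. Qed.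

(** The subbasic neighbourhoods of {1} are of two kinds. Those given by an open
    set contain every subgroup, as that open set contains 1; and finitely many
    of those given by compact sets amount to a single one, given by the union
    of the compact sets. *)
Lemma chabauty_nbhs1 (X : set Sub) (H0 : Sub) : (H0 : set G) = [set 1%g] ->
  closed X -> ~ X H0 ->
  exists C : set G, [/\ compact C, ~ C 1%g & forall H, X H -> (H : set G) `&` C !=set0].
Proof.
move=> H01 cX XH0.
have oX : open (~` X) by exact: closed_openC.
have [D [sD DH0 DX]] := open_subbase oX XH0.
pose cpt (W : set Sub) : set G := if pselect (exists C : set G, compact C /\
    W = [set H : Sub | (H : set G) `&` C = set0]) is left ex then projT1 (cid ex) else set0.
have cptP W : compact (cpt W).
  by rewrite /cpt; case: pselect => [ex|_]; [have [] := projT2 (cid ex) | exact: compact0].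
have cpt1 W : W \in D -> ~ cpt W 1%g.
  move=> /DH0; rewrite /cpt; case: pselect => [ex|_ _ []].
  have [_ {1}->] /= := projT2 (cid ex); rewrite H01 => E C1.
  by have : (set0 : set G) 1%g by rewrite -E.
exists (\big[setU/set0]_(W <- D) cpt W); split.
- by apply: bigsetU_compact.
- by rewrite -bigcup_fset => -[W /= WD]; exact: cpt1.
move=> H XH; apply/set0P/eqP => HC0.
suff : (~` X) H by apply.
apply: DX => W WD; case: (sD _ WD) => [[V [oV cV WE]]|ex].
  rewrite WE; exists 1%g; split; first by have /group_closed_setP[] := closed_subgroup_group H.
  by have := DH0 _ WD; rewrite WE => -[x []]; rewrite H01 => ->.
have WE : W = [set H : Sub | (H : set G) `&` cpt W = set0].
  rewrite /cpt; case: pselect => [ex'|[]] //.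
  by have [_ {1}->] := projT2 (cid ex').
rewrite WE /= -subset0 => x [Hx cx]; suff : (set0 : set G) x by [].
rewrite -HC0; split=> //; rewrite -bigcup_fset; by exists W.
Qed.

Lemma conj_fun_continuous (g : G) : continuous (fun x : G => (g^-1 * x * g)%g).
Proof.
have mulc (a b : G -> G) : continuous a -> continuous b ->
    continuous (fun x => (a x * b x)%g).
  move=> ca cb x.
  apply: (@continuous_comp _ _ _ (fun x => (a x, b x)) (fun x => x.1 * x.2)%g).
    by apply: cvg_pair => /=; [exact: ca|exact: cb].
  exact: mulg_continuous.
apply: (mulc _ _) => [|y]; last exact: cvg_cst.
by apply: mulc => y; [exact: cvg_cst|exact: cvg_id].
Qed.

Lemma conj_funK (g : G) :
  cancel (fun x : G => (g^-1 * x * g)%g) (fun x : G => (g^-1^-1 * x * g^-1)%g).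
Proof. by move=> x; rewrite invgK !mulgA mulgV mul1g -mulgA mulgV mulg1. Qed.

Lemma conj_preimage (g : G) (V : set G) :
  (fun x : G => (g^-1^-1 * x * g^-1)%g) @^-1` V = (fun x => (g^-1 * x * g)%g) @` V.
Proof.
rewrite eqEsubset; split=> [x Vx|_ [x Vx <-]].
  exists (g^-1^-1 * x * g^-1)%g => //.
  by rewrite invgK !mulgA mulVg mul1g -mulgA mulVg mulg1.
by rewrite /preimage /= conj_funK.
Qed.

Lemma conj_compact (g : G) (C : set G) : compact C ->
  compact ((fun x : G => (g * x * g^-1)%g) @^-1` C).
Proof.
move=> cC; have := conj_preimage g C; rewrite invgK => ->.
apply: continuous_compact => //; apply: continuous_subspaceT.
exact: conj_fun_continuous.
Qed.

Lemma conj_meets (g : G) (H : Sub) (V : set G) :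
  conj_set g H `&` V !=set0 <-> (H : set G) `&` ((fun x => (g * x * g^-1)%g) @^-1` V) !=set0.
Proof.
split=> [[_ [[h Hh <-] Vh]]|[h [Hh Vh]]]; first by exists h.
by exists (g * h * g^-1)%g; split=> //; exists h.
Qed.

Lemma conj_subgroup_open (g : G) (U : set Sub) : open U ->
  open (conj_subgroup g @^-1` U).
Proof.
suff sub (W : set Sub) : chabauty_subbase W -> chabauty_subbase (conj_subgroup g @^-1` W).
  move=> oU; rewrite openE => H UH.
  have [D [sD DH DU]] := open_subbase oU UH.
  have : nbhs H (\bigcap_(W in [set` D]) (conj_subgroup g @^-1` W)).
    apply: filter_bigI => W WD; apply: open_nbhs_nbhs; split; last exact: DH.
    exact/chabauty_subbase_open/sub/sD.
  by apply: filterS => H' DH'; apply: DU => W WD; exact: DH'.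
have cont : continuous (fun x : G => (g * x * g^-1)%g).
  by have := @conj_fun_continuous g^-1%g; rewrite invgK.
case=> [[V [oV cV ->]]|[C [cC ->]]].
  left; exists ((fun x => (g * x * g^-1)%g) @^-1` V); split.
  - by apply: open_comp => // x _; exact: cont.
  - apply: (@subclosed_compact _ _ ((fun x => (g * x * g^-1)%g) @^-1` closure V)).
    + exact: closed_closure.
    + exact: conj_compact.
    + have cl : closed ((fun x => (g * x * g^-1)%g) @^-1` closure V).
        by apply: closed_comp; [move=> x _; exact: cont | exact: closed_closure].
      rewrite [X in _ `<=` X]((closure_id _).1 cl).
      by apply: closureS => x Vx; apply: subset_closure.
  - by rewrite predeqE => H; exact: conj_meets.
right; exists ((fun x => (g * x * g^-1)%g) @^-1` C); split; first exact: conj_compact.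
rewrite predeqE => H /=; split=> E; rewrite -subset0 => x [].
  move=> Hx Cx; have : (conj_set g H `&` C) (g * x * g^-1)%g by split=> //; exists x.
  by rewrite E.
move=> [h Hh <-] Ch.
have : ((H : set G) `&` (fun x => (g * x * g^-1)%g) @^-1` C) h by [].
by rewrite E.
Qed.

End ChabautyGeneric.

Section BorelSub.
Variable G : lcscGroupType.
Local Notation Sub := (closed_subgroup G).

Lemma open_borel (U : set (borel_Sub G)) : open (U : set Sub) -> measurable U.
Proof. exact: sub_sigma_algebra. Qed.

Lemma conj_subgroup_measurable (g : G) (A : set (borel_Sub G)) : measurable A ->
  measurable (conj_subgroup g @^-1` A : set (borel_Sub G)).
Proof.
move=> mA.
have : <<s @open Sub >> `<=` [set A : set Sub | <<s @open Sub >> (conj_subgroup g @^-1` A)].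
  apply: smallest_sub; last by move=> U oU; apply: sub_sigma_algebra; exact: conj_subgroup_open.
  split=> /= [|B mB|F mF].
  - by rewrite preimage_set0; exact: sigma_algebra0.
  - have -> : conj_subgroup g @^-1` (setT `\` B) = setT `\` (conj_subgroup g @^-1` B) by [].
    exact: sigma_algebraCD.
  - by rewrite preimage_bigcup; exact: sigma_algebra_bigcup.
exact.
Qed.

Lemma conj_subgroup_trivial (g : G) : conj_subgroup g (trivial_subgroup G) = trivial_subgroup G.
Proof.
apply: closed_subgroup_inj; rewrite /= /conj_set image_set1 mulg1 mulgV //.
Qed.

Lemma conj_subgroup_whole (g : G) : conj_subgroup g (whole_subgroup G) = whole_subgroup G.
Proof.
apply: closed_subgroup_inj; rewrite /= eqEsubset; split=> // x _.
by exists (g^-1 * x * g)%g => //; rewrite !mulgA mulgV mul1g -mulgA mulgV mulg1.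
Qed.

End BorelSub.

(** * Traces on the finite groups and uniformly recurrent subgroups *)

Lemma compact_increasing_cover (T : topologicalType) (C : set T) (O : nat -> set T) :
  compact C -> (forall n, open (O n)) -> (forall n m, (n <= m)%N -> O n `<=` O m) ->
  (forall x, C x -> exists n, O n x) -> exists n, C `<=` O n.
Proof.
move=> cC oO leO covC; apply: contrapT => /forallNP no.
pose F := filter_from [set: nat] (fun n => C `\` O n).
have FF : ProperFilter F.
  apply: filter_from_proper => [|n _]; last first.
    by have /existsNP[x /not_implyP[Cx nOx]] := no n; exists x.
  apply: filter_from_filter; first by exists 0.
  move=> n m _ _; exists (maxn n m) => // x [Cx nO].
  by split; split=> // /leO Ox; apply: nO; apply: Ox; rewrite ?leq_maxl ?leq_maxr.
have [|x [Cx clx]] := cC F FF; first by exists 0 => // x [].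
have [n Onx] := covC _ Cx.
have [||y [[_ nOy] Oy]] := clx (C `\` O n) (O n); [by exists n | | by []].
exact: open_nbhs_nbhs.
Qed.

Section Levels.
Variable K : nat -> finGroupType.
Local Notation P := (prod_group K).
Local Notation G := (limit K).
Local Notation Sub := (closed_subgroup G).
Local Open Scope group_scope.

(** The image in V_n of the intersection of H with V_n x W_n. *)
Definition level n (H : Sub) : {set tower K n} :=
  [set v | `[< (H : set G) `&` cylinder v !=set0 >]]%SET.

Lemma levelP n (H : Sub) (v : tower K n) :
  v \in level n H <-> exists w, (H : set G) (emb v w).
Proof.
rewrite inE; split=> [/asboolP[x [Hx [w _ wE]]]|[w Hw]].
  by exists w; rewrite wE.
by apply/asboolP; exists (emb v w); split=> //; exists w.
Qed.

Lemma subgroup1 (H : Sub) : (H : set G) 1.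
Proof. by have /group_closed_setP[] := closed_subgroup_group H. Qed.

Lemma subgroupMV (H : Sub) x y : (H : set G) x -> (H : set G) y -> (H : set G) (x * y^-1).
Proof. by have /group_closed_setP[_] := closed_subgroup_group H; apply. Qed.

Lemma subgroupM (H : Sub) x y : (H : set G) x -> (H : set G) y -> (H : set G) (x * y).
Proof.
move=> Hx Hy; rewrite -[y]invgK; apply: subgroupMV => //.
by rewrite -[y^-1]mul1g; apply: subgroupMV => //; exact: subgroup1.
Qed.

Lemma level_group n (H : Sub) : group_set (level n H).
Proof.
apply/group_setP; split; first by apply/levelP; exists 1; rewrite emb1; exact: subgroup1.
move=> v v' /levelP[w Hw] /levelP[w' Hw']; apply/levelP; exists (w * w').
by rewrite embM; exact: subgroupM.
Qed.

(** Elements of V_n commute with W_n, so this conjugation descends to V_n. *)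
Lemma level_conj n (c : tower K n) (H : Sub) :
  level n (conj_subgroup (emb c 1) H) = (level n H :^ c^-1)%g.
Proof.
apply/setP => v; rewrite mem_conjgV; apply/idP/idP => /levelP[w].
  move=> [h Hh E]; apply/levelP; exists w.
  suff -> : emb (v ^ c) w = h by [].
  have -> : h = (emb c 1)^-1 * emb v w * emb c 1.
    by rewrite -E !mulgA mulVg mul1g -mulgA mulVg mulg1.
  by rewrite embV -!embM invg1 mul1g mulg1 /conjg mulgA.
move=> Hw; apply/levelP; exists w; exists (emb (v ^ c) w) => //.
by rewrite embV -!embM invg1 mul1g mulg1 conjgE !mulgA mulgV mul1g -mulgA mulgV mulg1.
Qed.

Lemma level_mem_open n (v : tower K n) : open [set H : Sub | v \in level n H].
Proof.
have := @meets_open G (cylinder v) (@cylinder_open _ _ v).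
rewrite -(closure_id _).1; last exact: cylinder_closed.
move=> /(_ (@cylinder_compact _ _ v)); congr (open _).
by rewrite predeqE => H /=; rewrite inE; split=> /asboolP.
Qed.

(** Both properties concern the copy of V_n x K_n in V_(n+1). A touched subgroup
    is most often saturated: this is the purpose of the choice of V_(n+1). *)
Definition saturated n (H : Sub) : bool :=
  [forall d, @stage_emb (tower K n * K n)%type n d \in level n.+1 H].

Definition touched n (H : Sub) : bool :=
  [exists d, (d != 1%g) && (@stage_emb (tower K n * K n)%type n d \in level n.+1 H)].

Lemma touched_of n (H : Sub) (g : G) m : (n <= m)%N -> (H : set G) g ->
  (exists (v : tower K n) w, g = emb v w) -> ~ (exists w, g = tail n w) -> touched m H.
Proof.
move=> nm Hg [v [w gE]] ng; apply/existsP.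
have [v' v'E] := emb_up v w nm; exists (v', w m); apply/andP; split.
  apply/eqP => -[v1 w1]; apply: ng.
  have [w' w'E] := tail_le w (leqW nm); exists w'; rewrite -w'E gE v'E emb_climb v1 w1.
  by rewrite /tail climb1.
by apply/levelP; exists w; rewrite -[@stage_emb _ _ _]/(climb v' (w m)) -emb_climb -v'E -gE.
Qed.

(** A nontrivial g in H lies in V_m x W_m for all large m but, for m large, not
    in W_m. *)
Lemma touched_eventually (H : Sub) : H <> trivial_subgroup G ->
  exists n, forall m, (n <= m)%N -> touched m H.
Proof.
move=> H1.
have [g Hg g1] : exists2 g, (H : set G) g & g != 1.
  apply: contrapT => no; apply: H1; apply: closed_subgroup_inj; rewrite eqEsubset; split=> g.
    by move=> Hg; apply/eqP/negPn/negP => g1; apply: no; exists g.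
  by move=> ->; exact: subgroup1.
have [n ng] : exists n, ~ exists w, g = tail n w.
  rewrite eq_sym in g1; have [n ng] := limit_separated g1; exists n => -[w gE].
  by apply: ng; exists w; rewrite mul1g.
have [j [v [w [nj gE]]]] := emb_surj_ge g n.
exists j => m jm; apply: (touched_of jm Hg); first by exists v, w.
by move=> [w' gE']; apply: ng; have [w'' E] := tail_le w' nj; exists w''; rewrite -E.
Qed.

(** For arbitrarily large m, H meets every coset of W_(m+1) that is contained in
    V_m x W_m; so it is dense. *)
Lemma saturated_whole (H : Sub) : (forall n, exists m, (n <= m)%N /\ saturated m H) ->
  H = whole_subgroup G.
Proof.
move=> spr; apply: closed_subgroup_inj; rewrite eqEsubset; split=> // g _.
apply: closed_subgroup_closed => A /limit_nbhsP[n nA].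
have [j [v [w [nj gE]]]] := emb_surj_ge g n.
have [m [jm /forallP sm]] := spr j.
have [v' v'E] := emb_up v w jm.
have /levelP[u Hu] := sm (v', w m).
exists (emb (climb v' (w m)) u); split=> //.
have -> : emb (climb v' (w m)) u = g * tail m.+1 (w^-1 * u).
  by rewrite gE v'E [emb v' w]emb_climb emb_tail mulgA mulgV mul1g.
have [w' ->] := tail_le (w^-1 * u) (leqW (leq_trans nj jm)); exact: nA.
Qed.

Lemma nontrivial_open : open (~` [set trivial_subgroup G] : set Sub).
Proof.
rewrite openE => H /= /touched_eventually[n tn].
have /existsP[d /andP[d1 dH]] := tn n (leqnn n).
apply: filterS (open_nbhs_nbhs (conj (level_mem_open _) dH)) => H' dH' H'1.
have {dH'}[w Hw] := (levelP H' _).1 dH'; have E : emb (stage_emb n d : tower K n.+1) w = 1.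
  by rewrite H'1 in Hw.
have : emb (stage_emb n d : tower K n.+1) w = emb (1 : tower K n.+1) 1 by rewrite E emb1.
move=> /emb_inj[+ _]; rewrite -(climb1 K n).
by move=> /(@stage_emb_inj (tower K n * K n)%type n) dE; rewrite dE eqxx in d1.
Qed.

(** If the trivial subgroup is not in X, all members of X meet a compact set C
    that omits 1. The sets V_n x W_n minus W_n are open, increase and cover C,
    so one of them contains C: from this n on, all members of X are touched.
    Then they are saturated, by stage_confined. *)
Lemma limit_URS (X : set Sub) : URS X ->
  X = [set trivial_subgroup G] \/ X = [set whole_subgroup G].
Proof.
move=> [cX iX [H0 XH0] minX].
have [X1|X1] := pselect (X (trivial_subgroup G)).
  left; apply/esym/minX; first by move=> _ ->.
  - by rewrite -[X in closed X]setCK; apply: open_closedC; exact: nontrivial_open.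
  - move=> g; rewrite image_set1; congr [set _]; exact: conj_subgroup_trivial.
  - by exists (trivial_subgroup G).
right.
have [C [cC C1 XC]] := chabauty_nbhs1 (erefl : (trivial_subgroup G : set G) = [set 1]) cX X1.
have [n CW] : exists n, forall g, C g ->
    (exists (v : tower K n) w, g = emb v w) /\ ~ exists w, g = tail n w.
  pose O n : set G := [set g | (exists (v : tower K n) w, g = emb v w) /\ ~ exists w, g = tail n w].
  have [|n m nm g [[v [w gE]] ng]|g Cg|n nO] := compact_increasing_cover (O := O) cC.
  - move=> n; rewrite -[open _]/(limit_open _) => g [[v [w gE]] ng]; exists n => u; split.
      by exists v, (w * u); rewrite gE emb_tail.
    move=> [u' E]; apply: ng; exists (u' * u^-1).
    by rewrite tailM -E -tailV -mulgA mulgV mulg1.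
  - split; first by have [v' v'E] := emb_up v w nm; exists v', w; rewrite gE.
    by move=> [u uE]; apply: ng; have [u' E] := tail_le u nm; exists u'; rewrite -E.
  - have g1 : 1 != g by apply/eqP => g1; apply: C1; rewrite g1.
    have [n ng] := limit_separated g1.
    have [j [v [w [nj gE]]]] := emb_surj_ge g n; exists j; split; first by exists v, w.
    move=> [u uE]; apply: ng; have [u' E] := tail_le u nj; exists u'.
    by rewrite mul1g -E.
  by exists n => g /nO.
have touchX m H : (n <= m)%N -> X H -> touched m H.
  move=> nm /XC[g [Hg Cg]]; have [gn ng] := CW g Cg.
  exact: touched_of nm Hg gn ng.
have saturatedX m H : (n <= m)%N -> X H -> saturated m H.
  move=> nm XH; apply/forallP => d.
  pose S (L : {set stage (tower K m * K m)%type m}) := exists2 H, X H & L = level m.+1 H.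
  apply: (@stage_confined _ _ S _ _ _ (level m.+1 H)).
  - move=> L c [H' XH' ->]; exists (conj_subgroup (emb (c^-1 : tower K m.+1) 1) H').
      by rewrite -(iX (emb (c^-1 : tower K m.+1) 1)); exists H'.
    by rewrite (@level_conj m.+1) invgK.
  - by move=> L [H' XH' ->]; exact: (@level_group m.+1).
  - move=> L [H' XH' ->]; have /existsP[f /andP[f1 fL]] := touchX m H' nm XH'.
    by exists f.
  - by exists H.
have XG H : X H -> H = whole_subgroup G.
  move=> XH; apply: saturated_whole => j; exists (maxn j n).
  by rewrite leq_maxl saturatedX ?leq_maxr.
by rewrite eqEsubset; split=> [H /XG ->|_ ->] //; rewrite -(XG _ XH0).
Qed.

End Levels.

(** * Invariant random subgroups *)

Section RandomSubgroups.
Variable K : nat -> finGroupType.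
Local Notation P := (prod_group K).
Local Notation G := (limit K).
Local Notation Sub := (closed_subgroup G).
Local Notation BSub := (borel_Sub G).
Local Open Scope ring_scope.

Lemma level_mem_measurable n (v : tower K n) :
  measurable ([set H : Sub | v \in level n H] : set BSub).
Proof. by apply: open_borel; exact: level_mem_open. Qed.

Lemma level_eq_measurable n (L : {set tower K n}) :
  measurable ([set H : Sub | level n H = L] : set BSub).
Proof.
have -> : [set H : Sub | level n H = L] =
    \bigcap_(v in [set: tower K n]) (if v \in L then [set H : Sub | v \in level n H]
      else ~` [set H : Sub | v \in level n H]).
  rewrite eqEsubset; split=> [H /= HL v _|H HL].
    by case: ifP => vL; rewrite /= HL vL.
  apply/setP => v; have := HL v I.
  by case: ifP => [_ ->|_ /= /negP/negbTE ->].
apply: (@fin_bigcap_measurable _ BSub) => [|v _]; first exact: finite_finset.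
case: ifP => _; first exact: level_mem_measurable.
by apply: measurableC; exact: level_mem_measurable.
Qed.

Variables (R : realType) (mu : probability BSub R).

Definition level_weight n (L : {set tower K n}) : R := fine (mu [set H : Sub | level n H = L]).

Lemma level_weightE n (L : {set tower K n}) :
  mu [set H : Sub | level n H = L] = (level_weight L)%:E.
Proof. by rewrite /level_weight fineK // fin_num_measure //; exact: level_eq_measurable. Qed.

Lemma level_pred_measure n (Q : pred {set tower K n}) :
  measurable ([set H : Sub | Q (level n H)] : set BSub) /\
  mu [set H : Sub | Q (level n H)] = (\sum_(L | Q L) level_weight L)%:E.
Proof.
have -> : [set H : Sub | Q (level n H)] = [set H : Sub | level n H \in enum Q].
  by rewrite predeqE => H /=; rewrite mem_enum.
rewrite -big_enum /=.
have : uniq (enum Q) by exact: enum_uniq.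
elim: (enum Q) => [_|L s IH /= /andP[Ls us]].
  rewrite big_nil; have -> : [set H : Sub | level n H \in [::]] = set0.
    by rewrite -subset0.
  by rewrite measure0.
have [ms mus] := IH us.
have -> : [set H : Sub | level n H \in L :: s] =
    [set H : Sub | level n H = L] `|` [set H : Sub | level n H \in s].
  rewrite predeqE => H /=; rewrite inE; split=> [/orP[/eqP|]|[->|->]];
    by [left|right|rewrite ?eqxx|rewrite orbT].
split; first by apply: measurableU => //; exact: level_eq_measurable.
rewrite measureU //; [|exact: level_eq_measurable|].
  by rewrite big_cons EFinD -level_weightE -mus.
rewrite -subset0 => H [/= -> HL].
by move: Ls; rewrite HL.
Qed.

Hypothesis mu_inv : IRS mu.

Lemma level_weight_conj n (L : {set tower K n}) (c : tower K n) :
  level_weight (L :^ c)%g = level_weight L.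
Proof.
have := mu_inv (emb c 1%g) (level_eq_measurable L).
rewrite /level_weight => <-; congr (fine (mu _)).
rewrite predeqE => H /=; rewrite level_conj; split=> [->|<-].
  by rewrite conjsgK.
by rewrite conjsgKV.
Qed.

Lemma touched_unsaturated_measure n :
  measurable ([set H : Sub | touched n H && ~~ saturated n H] : set BSub) /\
  (mu [set H : Sub | touched n H && ~~ saturated n H] <= (n.+1%:R^-1)%:E)%E.
Proof.
pose D := (tower K n * K n)%type.
have [mE ->] := @level_pred_measure n.+1 (fun L =>
  [exists f : D, (f != 1%g) && (stage_emb n f \in L)%g] &&
  ~~ [forall d : D, stage_emb n d \in L]%g).
split=> //; rewrite lee_fin.
apply: (@stage_random D n R (@level_weight n.+1)).
- by move=> L; rewrite fine_ge0.
- by move=> L c; exact: (@level_weight_conj n.+1 L c).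
- move=> L; rewrite /level_weight => w0.
  have [[H HL]|no] := pselect (exists H : Sub, level n.+1 H = L).
    by rewrite -HL; exact: (@level_group K n.+1 H).
  have E0 : [set H : Sub | level n.+1 H = L] = set0.
    by rewrite -subset0 => H /= HL; apply: no; exists H.
  by move: w0; rewrite E0 measure0 eqxx.
- have [_] := @level_pred_measure n.+1 xpredT.
  have -> : [set H : Sub | xpredT (level n.+1 H)] = setT by rewrite eqEsubset.
  by rewrite probability_setT => E; apply: EFin_inj; rewrite -E.
Qed.

(** A closed subgroup other than 1 and G is touched and not saturated at all
    large levels, and at level n this has probability at most 1 / n.+1. *)
Lemma IRS_two_points :
  mu.-negligible (~` [set trivial_subgroup G; whole_subgroup G]).
Proof.
pose F n : set BSub := \bigcap_(m in [set m | (n <= m)%N])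
  [set H : Sub | touched m H && ~~ saturated m H].
apply: (@negligibleS _ BSub R mu (\bigcup_n F n)).
  move=> H /= /not_orP[H1 HG]; have [n tn] := touched_eventually H1.
  have [j sj] : exists j, forall m, (j <= m)%N -> ~~ saturated m H.
    apply: contrapT => /forallNP no; apply: HG; apply: saturated_whole => j.
    have /existsNP[m /not_implyP[jm /negP/negPn sm]] := no j.
    by exists m.
  exists (maxn n j) => // m /=; rewrite geq_max => /andP[nm jm].
  by rewrite tn // sj.
apply: negligible_bigcup => n.
have mF : measurable (F n).
  apply: bigcap_measurable; first by exists n => /=.
  by move=> m _; have [] := touched_unsaturated_measure m.
suff F0 : mu (F n) = 0%E by apply/negligibleP.
apply/eqP; rewrite eq_le measure_ge0 andbT.
have Ffin : mu (F n) \is a fin_num by rewrite fin_num_measure.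
rewrite -(fineK Ffin) lee_fin leNgt; apply/negP => F0.
have [m mP] : exists m, (m.+1%:R^-1 < fine (mu (F n))).
  exists (Num.truncn (fine (mu (F n)))^-1); rewrite invf_plt ?posrE ?ltr0n //.
  exact: truncnS_gt.
have : (mu (F n) <= ((maxn n m).+1%:R^-1)%:E)%E.
  have [mE le] := touched_unsaturated_measure (maxn n m); apply: le_trans le.
  apply: le_measure; rewrite ?inE //.
  by move=> H; apply; rewrite /= leq_maxl.
rewrite -(fineK Ffin) lee_fin => /(lt_le_trans mP).
rewrite ltNge => /negP; apply.
by rewrite lef_pV2 ?posrE ?ltr0n // ler_nat ltnS leq_maxr.
Qed.

Lemma trivial_measurable : measurable ([set trivial_subgroup G] : set BSub).
Proof.
rewrite -[X in measurable X]setCK; apply: measurableC; apply: open_borel.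
exact: nontrivial_open.
Qed.

Lemma limit_IRS : exists t : R, 0 <= t <= 1 /\
  forall A : set BSub, measurable A ->
    mu A = (t%:E * \d_(trivial_subgroup G : BSub) A +
            (1 - t)%:E * \d_(whole_subgroup G : BSub) A)%E.
Proof.
pose T1 : set BSub := [set trivial_subgroup G].
have m1 : measurable T1 by exact: trivial_measurable.
have mT1 : mu T1 = (fine (mu T1))%:E by rewrite fineK // fin_num_measure.
have mnT1 : mu (~` T1) = (1 - fine (mu T1))%:E.
  by rewrite probability_setC // {1}mT1 -EFinB.
exists (fine (mu T1)); split.
  by rewrite fine_ge0 //= -lee_fin -mT1 probability_le1.
move=> A mA; rewrite !diracE.
have mAD : measurable (A `\` T1) by exact: measurableD.
have null : forall B : set BSub, measurable B ->
    B `<=` ~` [set trivial_subgroup G; whole_subgroup G] -> mu B = 0%E.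
  by move=> B mB sB; apply: measure_negligible => //; exact: negligibleS sB IRS_two_points.
rewrite (measureDI mu mA m1) addeC; congr (_ + _)%E.
  have [A1|A1] := boolP (_ \in A).
    have -> : A `&` T1 = T1 by rewrite setIC; apply/setIidPl => _ ->; exact: set_mem.
    by rewrite mule1 mT1.
  have -> : A `&` T1 = set0.
    by rewrite -subset0 => H [AH H1]; move/negP: A1; apply; rewrite -H1; exact: mem_set.
  by rewrite measure0 mule0.
have [AG|AG] := boolP (_ \in A).
  rewrite mule1 -mnT1.
  have mnA : measurable (~` T1 `\` A) by apply: measurableD => //; exact: measurableC.
  rewrite (measureDI mu (measurableC m1) mA) [X in _ = (X + _)%E](null _ mnA).
    by rewrite add0e setIC setDE.
  by move=> H [H1 nA] [//|HG]; apply: nA; rewrite HG; exact: set_mem.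
rewrite mule0; apply: null => // H [AH H1] [//|HG].
by move/negP: AG; apply; rewrite -HG; exact: mem_set.
Qed.

End RandomSubgroups.

Section RandomSubgroupsConverse.
Local Open Scope ring_scope.
Variables (G : lcscGroupType) (R : realType) (mu : probability (borel_Sub G) R).

Lemma two_points_IRS (t : R) :
  (forall A : set (borel_Sub G), measurable A ->
    mu A = (t%:E * \d_(trivial_subgroup G : borel_Sub G) A +
            (1 - t)%:E * \d_(whole_subgroup G : borel_Sub G) A)%E) -> IRS mu.
Proof.
move=> muE g A mA; rewrite !muE //; last exact: conj_subgroup_measurable.
have E (H : borel_Sub G) : conj_subgroup g H = H ->
    (\d_H (conj_subgroup g @^-1` A) : \bar R) = \d_H A.
  move=> gH; rewrite !diracE; congr (_%:R%:E); congr nat_of_bool.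
  by apply/idP/idP => /set_mem HA; apply/mem_set; move: HA; rewrite /preimage /= gH.
by rewrite !E //; [exact: conj_subgroup_whole | exact: conj_subgroup_trivial].
Qed.

End RandomSubgroupsConverse.

(** * Products indexed by a countable type *)

Section Slots.
Local Open Scope group_scope.
Variables (I : countType) (K : I -> finGroupType).

Definition slot_of (o : option I) : finGroupType :=
  if o is Some i then K i else {perm void}.
Definition slot (n : nat) : finGroupType := slot_of (choice.pickle_inv n).

Definition cast_slot (o o' : option I) (e : o = o') : slot_of o -> slot_of o' :=
  fun k => eq_rect o slot_of k o' e.

Lemma cast_slotM o o' (e : o = o') : {morph cast_slot e : k k' / k * k'}.
Proof. by case: _ / e. Qed.

Definition fill_slot (w : prod_group K) (o : option I) : slot_of o :=
  if o is Some i then w i else 1.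

Lemma cast_fill w o o' (e : o = o') : cast_slot e (fill_slot w o) = fill_slot w o'.
Proof. by case: _ / e. Qed.

Definition collect (w : prod_group slot) : prod_group K :=
  fun i => cast_slot (choice.pickleK_inv i) (w (choice.pickle i)).

Definition distribute (w : prod_group K) : prod_group slot :=
  fun n => fill_slot w (choice.pickle_inv n).

Lemma collectM : {morph collect : w w' / w * w'}.
Proof.
move=> w w'; apply: functional_extensionality_dep => i.
exact: (cast_slotM (choice.pickleK_inv i) (w (choice.pickle i)) (w' (choice.pickle i))).
Qed.

Lemma distributeK : cancel distribute collect.
Proof.
move=> w; apply: functional_extensionality_dep => i.
exact: (cast_fill w (choice.pickleK_inv i)).
Qed.

Lemma collectK : cancel collect distribute.
Proof.
move=> w; apply: functional_extensionality_dep => n.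
suff H o (e : choice.pickle_inv n = o) : fill_slot (collect w) o = cast_slot e (w n).
  exact: (H _ erefl).
case: o e => [i|] e; last by apply/permP => -[].
have ni : choice.pickle i = n by have := choice.pickle_invK n (T := I); rewrite e.
by subst n; rewrite (Prop_irrelevance e (choice.pickleK_inv i)).
Qed.

Lemma collect_continuous : continuous collect.
Proof.
apply: continuous_prod_group => w i; have FF := nbhs_filter w.
apply: (@filterS _ _ FF) (prod_coord_near w (choice.pickle i)) => w' E.
by rewrite /collect E.
Qed.

Lemma distribute_continuous : continuous distribute.
Proof.
apply: continuous_prod_group => w n; have FF := nbhs_filter w.
suff near o : nbhs w (fun w' : prod_group K => fill_slot w' o = fill_slot w o).
  exact: near (choice.pickle_inv n).
case: o => [i|]; first exact: (prod_coord_near w i).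
by apply: (@filterS _ _ FF setT) => //; exact: filterT.
Qed.

End Slots.

Local Open Scope ring_scope.

Theorem theorem1p3 (p : nat) (p_prime : prime p)
    (I : countType) (K : I -> finGroupType) :
  exists G : lcscGroupType,
    [/\ totally_disconnected [set: G],
        exists f : {multiplicative G -> homeo (padic p_prime)},
          injective f /\ (forall g : G, PL (f g)),
        locally_isomorphic G (prod_group K),
        forall (R : realType) (mu : probability (borel_Sub G) R),
          IRS mu <->
          exists t : R, 0 <= t <= 1 /\
            forall A : set (borel_Sub G), measurable A ->
              mu A = (t%:E * \d_(trivial_subgroup G : borel_Sub G) A +
                      (1 - t)%:E * \d_(whole_subgroup G : borel_Sub G) A)%E &
        forall X : set (closed_subgroup G), URS X ->
          X = [set trivial_subgroup G] \/ X = [set whole_subgroup G]].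
Proof.
exists (limit (slot K)); split.
- exact: limit_totally_disconnected.
- exact: limit_PL.
- exact: (limit_locally_isomorphic (@collect_continuous I K)
    (@distribute_continuous I K) (@collectK I K) (@distributeK I K) (@collectM I K)).
- move=> R mu; split=> [/limit_IRS //|[t [_ muE]]].
  exact: two_points_IRS muE.
- exact: limit_URS.
Qed.
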